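(* Let $d\ge 1$ be an integer, and let $\nu_1$ and $\nu_2$ be Borel probability measures on $\mathbb{R}^d/\mathbb{Z}^d$ with the Euclidean metric. For any integer $H\ge 1$, $$W_1(\nu_1,\nu_2)\le \frac{6d}{H}+\frac{d^{1/2}}{2\pi}\left(\sum_{\substack{h\in\mathbb{Z}^d\\ 0<\|h\|_\infty<H}}\frac{|\widehat{\nu_1}(h)-\widehat{\nu_2}(h)|^2}{|h|^2}\right)^{1/2}.$$
   Context: The Euclidean metric on $\mathbb{R}^d/\mathbb{Z}^d$ is $\|x-y\|_{\mathbb{R}^d/\mathbb{Z}^d}=\min_{m\in\mathbb{Z}^d}|x-y-m|$, where $|\cdot|$ is the Euclidean norm; $\|h\|_\infty=\max_{1\le j\le d}|h_j|$ for $h\in\mathbb{Z}^d$. $W_1(\nu_1,\nu_2)=\inf_\vartheta\int\|x-y\|_{\mathbb{R}^d/\mathbb{Z}^d}\,\mathrm{d}\vartheta(x,y)$, where the infimum is over all Borel probability measures $\vartheta$ on $(\mathbb{R}^d/\mathbb{Z}^d)\times(\mathbb{R}^d/\mathbb{Z}^d)$ with marginals $\nu_1$ and $\nu_2$. The Fourier coefficients of a Borel probability measure $\nu$ on $\mathbb{R}^d/\mathbb{Z}^d$ are $\widehat{\nu}(h)=\int_{\mathbb{R}^d/\mathbb{Z}^d}e^{-2\pi i\langle h,x\rangle}\,\mathrm{d}\nu(x)$, $h\in\mathbb{Z}^d$, where $\langle h,x\rangle=\sum_{j=1}^d h_jx_j$. *)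

(* Defs.v *)
From HB Require Import structures.
From mathcomp Require Import all_boot all_order all_algebra.
From mathcomp Require Import generic_quotient ring_quotient archimedean.
From mathcomp Require Import all_classical all_reals all_analysis.
From mathcomp Require Import complex.

Set Implicit Arguments.
Unset Strict Implicit.
Unset Printing Implicit Defensive.

Import Order.TTheory GRing.Theory Num.Theory.
Import numFieldNormedType.Exports.

Local Open Scope classical_set_scope.
Local Open Scope ring_scope.

Definition Zlattice (R : realType) (d : nat) : pred 'rV[R]_d :=
  fun v => [forall j, v ord0 j \is a Num.int].

Lemma Zlattice_zmod_closed (R : realType) (d : nat) :
  zmod_closed (@Zlattice R d).
Proof.
split=> [|u v /forallP uZ /forallP vZ]; apply/forallP => j; rewrite !mxE.
  exact: rpred0.
exact: rpredB.
Qed.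
HB.instance Definition _ (R : realType) (d : nat) :=
  GRing.isZmodClosed.Build 'rV[R]_d (@Zlattice R d)
    (@Zlattice_zmod_closed R d).

Definition Zlattice_group (R : realType) (d : nat) : zmodClosed 'rV[R]_d :=
  GRing.ZmodClosed.clone 'rV[R]_d (@Zlattice R d) _.

(** R^d/Z^d with the quotient topology, which is the topology of the metric
    [tdist] below.  It is pointed by the class of 0. *)
Definition torus (R : realType) (d : nat) : Type :=
  quotient_topology (Quotient.quot (Zlattice_group R d)).
HB.instance Definition _ (R : realType) (d : nat) :=
  PointedTopological.on (torus R d).
HB.instance Definition _ (R : realType) (d : nat) := Quotient.on (torus R d).

HB.instance Definition _ (T U : ptopologicalType) := Pointed.on (T * U)%type.

(** Applied below to [torus R d] and to [torus R d * torus R d]; the latter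
    carries the Borel sets of the product topology. *)
Notation borel T := (g_sigma_algebraType (@open T)).

(** The library norm on row vectors is the sup norm, hence this one. *)
Definition enorm (R : realType) (d : nat) (v : 'rV[R]_d) : R :=
  Num.sqrt (\sum_(j < d) v ord0 j ^+ 2).

Definition Zvec (R : realType) (d : nat) (h : 'rV[int]_d) : 'rV[R]_d :=
  map_mx intr h.

Definition Zsupnorm (d : nat) (h : 'rV[int]_d) : nat :=
  (\max_(j < d) `|h ord0 j|)%N.

(** The infimum is over a translate of Z^d, so it is attained (a minimum) and
    does not depend on the chosen representatives. *)
Definition tdist (R : realType) (d : nat) (x y : torus R d) : R :=
  inf (range (fun m : 'rV[int]_d => enorm (repr x - repr y - Zvec R m))).

Definition coupling (R : realType) (d : nat)
    (nu1 nu2 : probability (borel (torus R d)) R)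
    (theta : probability (borel (torus R d * torus R d)%type) R) : Prop :=
  forall A : set (borel (torus R d)), measurable A ->
    theta [set p | A p.1] = nu1 A /\ theta [set p | A p.2] = nu2 A.

Definition W1 (R : realType) (d : nat)
    (nu1 nu2 : probability (borel (torus R d)) R) : \bar R :=
  ereal_inf [set (\int[theta]_p (tdist p.1 p.2)%:E)%E
            | theta in [set theta | coupling nu1 nu2 theta]].

Definition inner (R : realType) (d : nat) (h : 'rV[int]_d) (x : 'rV[R]_d) : R :=
  \sum_(j < d) (h ord0 j)%:~R * x ord0 j.

Definition cis (R : realType) (t : R) : R[i] := (cos t +i* sin t)%C.

Definition cintegral (R : realType) (disp : measure_display)
    (T : measurableType disp) (mu : {measure set T -> \bar R})
    (f : T -> R[i]) : R[i] :=
  Complex (\int[mu]_x complex.Re (f x)) (\int[mu]_x complex.Im (f x)).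

(** The integrand is Z^d-periodic, so it does not depend on the chosen
    representative of [x]. *)
Definition fourier_coef (R : realType) (d : nat)
    (nu : probability (borel (torus R d)) R) (h : 'rV[int]_d) : R[i] :=
  cintegral nu (fun x : torus R d => cis (- (2 * pi * inner h (repr x)))).

(* Main.v *)
Require Import Defs.
From HB Require Import structures.
From mathcomp Require Import all_boot all_order all_algebra.
From mathcomp Require Import all_classical all_reals all_analysis.
From mathcomp Require Import measurable_realfun.
From mathcomp Require Import complex.
From mathcomp Require Import ring lra zify.

Set Implicit Arguments.
Unset Strict Implicit.
Unset Printing Implicit Defensive.

Import Order.TTheory GRing.Theory Num.Theory.
Import numFieldNormedType.Exports.

Local Open Scope classical_set_scope.
Local Open Scope ring_scope.

Local Notation normc := ComplexField.Normc.normc.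

(** The Wasserstein distance is compared with a transport problem on the grid
    (Z/NZ)^d, where everything is a finite sum, and N tends to infinity with H
    fixed.

    The torus is cut into N^d half-open cubes.  A coupling of the masses that
    two measures give to the cubes extends to a coupling of the measures
    themselves, by product measures inside the cubes ([gluing]); since moving
    inside a cube is cheap ([tdist_le_gdist]), the distance W_1 exceeds the cost
    of the finite transport problem by at most d/N ([W1_le_grid]).  That cost is
    a supremum over Lipschitz functions on the grid by linear programming
    duality ([kantorovich_finite], from Farkas's lemma).

    It remains to pair an L-Lipschitz function f with the difference of the
    masses ([lipschitz_pairing]).  Convolving f with a tensor power of the
    Fejer-Korovkin kernel of degree less than H gives a trigonometric polynomial
    g = sum_h c_h e_h with frequencies of sup norm less than H.  The
    coefficients of this kernel form the lowest eigenvector of a discrete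
    Laplacian, so its mean displacement is at most 1/(H+1) in each coordinate
    ([sum_fk_weight_znorm]), and replacing f by g costs at most 2dL/(H+1), which
    is below 6dL/H.  As an average of translates of f, the function g still
    varies by at most L/N along each edge of the grid.  Parseval's identity for
    these increments, summed over the d directions, bounds
    (2 pi)^2 sum_h |c_h|^2 |h|^2 by d L^2 up to a factor that tends to 1
    ([trig_energy]); this is where the constant sqrt(d)/(2 pi) comes from.  The
    Cauchy-Schwarz inequality concludes ([trig_pairing]), because the Fourier
    coefficients of the discretized measures are within O(1/N) of the true ones
    ([fourier_discretization]). *)

(** * Linear programming duality *)

Lemma scalarN (F : realFieldType) (W : lmodType F) (f : W -> F) :
  scalar f -> forall x, f (- x) = - f x.
Proof.
move=> fl x; have f0 : f 0 = 0.
  by have := fl (-1) 0 0; rewrite scaler0 addr0; lra.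
by have := fl (-1) x 0; rewrite addr0 f0 scaleN1r; lra.
Qed.

(** Induction on the number of functionals.  If the last one is not redundant,
    some point makes it positive while [gamma] is positive and the others are
    nonpositive; on the kernel of the last functional the induction hypothesis
    applies, and the sign pattern at that point makes the last multiplier
    nonnegative. *)
Lemma farkas_ord (F : realFieldType) (W : lmodType F) (m : nat)
    (alpha : nat -> W -> F) (gamma : W -> F) :
  (forall i, scalar (alpha i)) -> scalar gamma ->
  (forall x, (forall i, (i < m)%N -> alpha i x <= 0) -> gamma x <= 0) ->
  exists2 lam : nat -> F, (forall i, 0 <= lam i) &
    forall x, gamma x = \sum_(i < m) lam i * alpha i x.
Proof.
elim: m alpha gamma => [|m IHm] alpha gamma alin glin imp.
  exists (fun=> 0) => // x; rewrite big_ord0; apply/eqP.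
  rewrite eq_le imp//= -oppr_le0 -(scalarN glin).
  exact: imp.
have [imp'|/existsNP[xb /not_implyP[xbm /negP]]] :=
  pselect (forall x, (forall i, (i < m)%N -> alpha i x <= 0) -> gamma x <= 0).
  have [lam lam0 gE] := IHm _ _ alin glin imp'.
  exists (fun i => if (i < m)%N then lam i else 0) => [i|x]; first by case: ifP.
  rewrite big_ord_recr/= ltnn mul0r addr0 gE; apply: eq_bigr => i _.
  by rewrite ltn_ord.
rewrite -ltNge => gxb.
have axb : 0 < alpha m xb.
  rewrite ltNge; apply/negP => am; move: gxb; rewrite ltNge => /negP; apply.
  by apply: imp => i; rewrite ltnS leq_eqVlt => /predU1P[->//|/xbm].
pose x0 := (alpha m xb)^-1 *: xb.
have sc (f : W -> F) : scalar f -> forall a u, f (a *: u) = a * f u.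
  move=> fl a u; have f0 : f 0 = 0.
    by have := scalarN fl 0; rewrite oppr0; lra.
  by rewrite -[a *: u]addr0 fl f0 addr0.
have ax0 : alpha m x0 = 1 by rewrite sc// mulVf// gt_eqF.
(* Projecting along [x0] onto the kernel of the last functional removes it. *)
pose pr (f : W -> F) x := f x - alpha m x * f x0.
have prlin f : scalar f -> scalar (pr f).
  by move=> fl a u v; rewrite /pr fl (alin m); ring.
have prE f x : scalar f -> pr f x = f (- alpha m x *: x0 + x).
  by move=> fl; rewrite fl /pr; ring.
have [lam lam0 gE] : exists2 lam : nat -> F, (forall i, 0 <= lam i) &
    forall x, pr gamma x = \sum_(i < m) lam i * pr (alpha i) x.
  apply: (IHm (fun i => pr (alpha i)) (pr gamma)) => [i||x xle];
    [exact: prlin|exact: prlin|].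
  rewrite prE//; apply: imp => i; rewrite ltnS leq_eqVlt => /predU1P[->|im].
    by rewrite -prE// /pr ax0 mulr1 subrr.
  by rewrite -prE//; exact: xle.
pose c := gamma x0 - \sum_(i < m) lam i * alpha i x0.
exists (fun i => if (i < m)%N then lam i else c) => [i|x].
  case: ifP => // _; rewrite subr_ge0; apply: (@le_trans _ _ 0).
    apply: sumr_le0 => k _; rewrite mulr_ge0_le0// sc// mulr_ge0_le0 ?xbm//.
    by rewrite invr_ge0 ltW.
  by rewrite sc// mulr_ge0// ?invr_ge0 ltW.
rewrite big_ord_recr/= ltnn.
under eq_bigr do rewrite ltn_ord.
have := gE x; rewrite /pr /c => /eqP; rewrite subr_eq => /eqP ->.
have -> : \sum_(i < m) lam i * (alpha i x - alpha m x * alpha i x0) =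
    \sum_(i < m) lam i * alpha i x
    - alpha m x * \sum_(i < m) lam i * alpha i x0.
  by rewrite mulr_sumr -sumrB; apply: eq_bigr => i _; ring.
ring.
Qed.

Lemma farkas (F : realFieldType) (W : lmodType F) (I : finType)
    (alpha : I -> W -> F) (gamma : W -> F) :
  (forall i, scalar (alpha i)) -> scalar gamma ->
  (forall x, (forall i, alpha i x <= 0) -> gamma x <= 0) ->
  exists2 lam : I -> F, (forall i, 0 <= lam i) &
    forall x, gamma x = \sum_i lam i * alpha i x.
Proof.
move=> alin glin imp.
pose al k := if insub k is Some i then alpha (enum_val (i : 'I_#|I|)) else fun=> 0.
have al_ord (i : 'I_#|I|) : al i = alpha (enum_val i) by rewrite /al valK.
have [||x xle|lam lam0 gE] := @farkas_ord F W #|I| al gamma.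
- move=> k; rewrite /al; case: insubP => [i _ _|_] //.
  by move=> a u v; rewrite mulr0 addr0.
- by [].
- apply: imp => i; rewrite -(enum_rankK i) -al_ord; exact/xle/ltn_ord.
exists (fun i => lam (enum_rank i)) => // x.
rewrite gE (reindex (@enum_rank I)) /=; last first.
  by exists enum_val => i _; rewrite ?enum_valK ?enum_rankK.
by apply: eq_bigr => i _; rewrite al_ord enum_rankK.
Qed.

(** The dual of the transport problem has two potentials [phi] and [psi] with
    [phi x + psi y <= c x y]; the triangle inequality replaces them by a single
    Lipschitz function.  Farkas's lemma concerns cones, so the constraint is made
    homogeneous by an extra coordinate [t], the scale [L] of the hypothesis. *)
Lemma kantorovich_finite (R : realFieldType) (G : finType) (x0 : G)
    (c : G -> G -> R) (p q : G -> R) (B : R) :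
  (forall x, c x x = 0) -> (forall x y z, c x z <= c x y + c y z) ->
  (forall x, 0 <= p x) -> (forall x, 0 <= q x) ->
  (forall (L : R) (f : G -> R), 0 <= L ->
     (forall x y, f x - f y <= L * c x y) ->
     \sum_x f x * (p x - q x) <= L * B) ->
  exists w : G -> G -> R,
    [/\ forall x y, 0 <= w x y, forall x, \sum_y w x y = p x,
        forall y, \sum_x w x y = q y & \sum_x \sum_y w x y * c x y <= B].
Proof.
move=> cxx tri p0 q0 dual.
pose W := ({ffun G -> R^o} * {ffun G -> R^o} * R^o)%type.
(* The index [inr tt] carries the constraint that the scale is nonnegative. *)
pose alpha (i : G * G + unit) (v : W) : R :=
  if i is inl xy then v.1.1 xy.1 + v.1.2 xy.2 - v.2 * c xy.1 xy.2 else - v.2.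
pose gamma (v : W) : R :=
  \sum_x v.1.1 x * p x + \sum_x v.1.2 x * q x - v.2 * B.
have alin i : scalar (alpha i).
  case: i => [[x y]|[]] a u v; rewrite /alpha /= ?ffunE /GRing.scale /=; ring.
have glin : scalar gamma.
  move=> a u v; rewrite /gamma /=.
  have sumE (g h r : G -> R) :
      \sum_x (a * g x + h x) * r x = a * \sum_x g x * r x + \sum_x h x * r x.
    by rewrite mulr_sumr -big_split; apply: eq_bigr => x _ /=; ring.
  under eq_bigr do rewrite !ffunE.
  under [X in _ + X - _ = _]eq_bigr do rewrite !ffunE.
  by rewrite !sumE /GRing.scale /=; ring.
have [|lam lam0 gE] := farkas alin glin.
  move=> [[phi psi] t] le0; rewrite /gamma /=.
  have t0 : 0 <= t by have := le0 (inr tt); rewrite /alpha/= oppr_le0.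
  have le1 x y : phi x + psi y <= t * c x y.
    by have := le0 (inl (x, y)); rewrite /alpha/= subr_le0.
  (* The c-transform of [psi] is a [t]-Lipschitz function lying above [phi]
     and below [- psi]. *)
  have [f fP] : exists f : G -> R, forall x,
      (forall y, f x <= t * c x y - psi y) /\ exists y, f x = t * c x y - psi y.
    exists (fun x => let y := [arg min_(y < x0) (t * c x y - psi y)]%O in
                     t * c x y - psi y) => x /=.
    by case: arg_minP => // y _ ymin; split=> [z|]; [exact: ymin|exists y].
  have flip x y : f x - f y <= t * c x y.
    have [fx _] := fP x; have [_ [z ->]] := fP y.
    have := fx z; have := ler_wpM2l t0 (tri x y z); lra.
  rewrite subr_le0; apply: le_trans (dual _ _ t0 flip).
  rewrite -big_split; apply: ler_sum => x _ /=; rewrite mulrBr.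
  apply: lerD.
    by apply: ler_wpM2r => //; have [_ [y ->]] := fP x; have := le1 x y; lra.
  rewrite -mulNr; apply: ler_wpM2r => //.
  by have [/(_ x) + _] := fP x; rewrite cxx; lra.
pose w x y := lam (inl (x, y)).
have {}gE v : gamma v = \sum_x \sum_y w x y * (v.1.1 x + v.1.2 y - v.2 * c x y)
    - lam (inr tt) * v.2.
  rewrite gE big_sumType/= pair_bigA/=; congr (_ + _).
    by apply: eq_bigr => -[x y] _.
  by rewrite (bigD1 tt)//= big1 ?addr0 ?mulrN// => -[].
have sum1 x (g : G -> R) : \sum_y (y == x)%:R * g y = g x.
  rewrite (bigD1 x)//= eqxx mul1r big1 ?addr0// => y /negPf ->.
  by rewrite mul0r.
exists w; split=> [x y|x|x|]; first exact: lam0.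
- have := gE ([ffun y => (y == x)%:R : R^o], 0, 0).
  rewrite /gamma/= mulr0 mul0r !subr0.
  under eq_bigr do rewrite ffunE.
  under [X in _ + X = _]eq_bigr do rewrite ffunE mul0r.
  rewrite sum1 big1 ?addr0// => ->.
  rewrite -[LHS](sum1 x (fun a => \sum_y w a y)); apply: eq_bigr => a _.
  rewrite mulr_sumr; apply: eq_bigr => b _; rewrite !ffunE; ring.
- have := gE (0, [ffun y => (y == x)%:R : R^o], 0).
  rewrite /gamma/= mulr0 mul0r !subr0.
  under eq_bigr do rewrite ffunE mul0r.
  under [X in _ + X = _]eq_bigr do rewrite ffunE.
  rewrite sum1 big1 ?add0r// => ->.
  rewrite exchange_big -[LHS](sum1 x (fun b => \sum_a w a b)) /=.
  apply: eq_bigr => b _.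
  rewrite mulr_sumr; apply: eq_bigr => a _; rewrite !ffunE; ring.
have := gE (0, 0, -1); rewrite /gamma/=.
have z0 (r : G -> R) : \sum_x (0 : {ffun G -> R^o}) x * r x = 0.
  by rewrite big1// => x _; rewrite ffunE mul0r.
rewrite !z0 => gE1; have := lam0 (inr tt).
suff -> : \sum_x \sum_y w x y * c x y = \sum_x \sum_y
    w x y * ((0 : {ffun G -> R^o}) x + (0 : {ffun G -> R^o}) y - -1 * c x y).
  by move: gE1; lra.
by apply: eq_bigr => x _; apply: eq_bigr => y _; rewrite !ffunE; ring.
Qed.

(** * Trigonometric inequalities and the circle group *)

Lemma ge0_sin_le (R : realType) (x : R) : 0 <= x -> sin x <= x.
Proof.
rewrite le_eqVlt => /predU1P[<-|x0]; first by rewrite sin0.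
have [c _] := @MVT_segment R sin cos 0 x (ltW x0)
  (fun y _ => is_derive_sin y) (continuous_subspaceT (@continuous_sin R)).
rewrite sin0 !subr0 => ->.
by rewrite -[leRHS]mul1r ler_wpM2r ?cos_le1// ltW.
Qed.

Lemma norm_sin_le (R : realType) (x : R) : `|sin x| <= `|x|.
Proof.
wlog x0 : x / 0 <= x => [hw|].
  have [/hw//|/ltW x0] := leP 0 x.
  by rewrite -normrN -sinN -[`|x|]normrN; apply: hw; rewrite oppr_ge0.
have [xpi|/ltW xpi] := leP x pi.
  by rewrite !ger0_norm ?ge0_sin_le// sin_ge0_pi// x0.
rewrite (ger0_norm x0) (le_trans (sin_max x))// (le_trans _ xpi)//.
by have := @pi_ge2 R; lra.
Qed.

Lemma mulr_cos_le_sin (R : realType) (x : R) :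
  0 <= x <= pi / 2 -> x * cos x <= sin x.
Proof.
case/andP; rewrite le_eqVlt => /predU1P[<- _|x0 xpi].
  by rewrite sin0 mul0r.
have [c /itvP cx] := @MVT_segment R sin cos 0 x (ltW x0)
  (fun y _ => is_derive_sin y) (continuous_subspaceT (@continuous_sin R)).
rewrite sin0 !subr0 => ->; rewrite [leRHS]mulrC.
rewrite ler_pM2l//.
have p0 := @pi_gt0 R.
have [c0 cx'] : 0 <= c /\ c <= x by rewrite !cx.
move: {cx} c0 cx' => c0 cx.
have [->//|cltx] := eqVneq c x; apply: ltW; rewrite ltr_cos.
- by rewrite lt_neqAle cltx cx.
- by rewrite in_itv/=; apply/andP; split; lra.
- by rewrite in_itv/=; apply/andP; split; lra.
Qed.

Lemma one_sub_cosE (R : realType) (x : R) : 1 - cos x = 2 * sin (x / 2) ^+ 2.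
Proof.
have -> : cos x = cos ((x / 2) *+ 2) by congr cos; rewrite mulr2n; lra.
rewrite cos_mulr2n sin2cos2 -mulr_natl; ring.
Qed.

Lemma one_sub_cos_le (R : realType) (x : R) : 2 - 2 * cos x <= x ^+ 2.
Proof.
have -> : 2 - 2 * cos x = (2 * sin (x / 2)) ^+ 2.
  by have := one_sub_cosE x; rewrite exprMn; lra.
rewrite -[leLHS]real_normK ?num_real// -[leRHS]real_normK ?num_real//.
rewrite ler_pXn2r// ?nnegrE//.
by rewrite normrM ger0_norm//; have := norm_sin_le (x / 2);
   rewrite normrM [`|2^-1|]ger0_norm//; lra.
Qed.


Lemma normc_sqr (R : realType) (z : R[i]) :
  normc z ^+ 2 = complex.Re z ^+ 2 + complex.Im z ^+ 2.
Proof. by case: z => a b; rewrite sqr_sqrtr// addr_ge0 ?sqr_ge0. Qed.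

Lemma normc_ge0 (R : realType) (z : R[i]) : 0 <= normc z.
Proof. by case: z => a b; rewrite sqrtr_ge0. Qed.

Lemma normc_sqrE (R : realType) (z : R[i]) :
  (normc z ^+ 2)%:C%C = z * conjc z.
Proof.
rewrite normc_sqr; case: z => a b; apply/eqP; rewrite eq_complex/=.
by apply/andP; split; apply/eqP; ring.
Qed.

Lemma normc_real (R : realType) (x : R) : normc x%:C%C = `|x|.
Proof. by rewrite /= expr0n addr0 sqrtr_sqr. Qed.

Lemma realcM (R : realType) (x y : R) : (x * y)%:C%C = x%:C%C * y%:C%C.
Proof. exact: rmorphM. Qed.

Lemma realc_sum (R : realType) (I : Type) (s : seq I) (f : I -> R) :
  (\sum_(i <- s) f i)%:C%C = \sum_(i <- s) (f i)%:C%C.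
Proof. exact: rmorph_sum. Qed.

Lemma realc_prod (R : realType) (I : Type) (s : seq I) (f : I -> R) :
  (\prod_(i <- s) f i)%:C%C = \prod_(i <- s) (f i)%:C%C.
Proof. exact: rmorph_prod. Qed.

Lemma Re_le_normc (R : realType) (z : R[i]) : complex.Re z <= normc z.
Proof.
apply: le_trans (ler_norm _) _; rewrite -ler_sqr ?nnegrE ?normc_ge0//.
by rewrite real_normK ?num_real// normc_sqr lerDl sqr_ge0.
Qed.

Lemma normc_le_ReIm (R : realType) (z : R[i]) :
  normc z <= `|complex.Re z| + `|complex.Im z|.
Proof.
rewrite -ler_sqr ?nnegrE ?normc_ge0 ?addr_ge0// normc_sqr sqrrD.
rewrite !real_normK ?num_real// lerD2r lerDl.
by rewrite mulrn_wge0// mulr_ge0.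
Qed.

Lemma normc_sum (R : realType) (I : Type) (s : seq I) (f : I -> R[i]) :
  normc (\sum_(i <- s) f i) <= \sum_(i <- s) normc (f i).
Proof.
elim/big_rec2: _ => [|i y z _ yz]; first by rewrite ComplexField.Normc.normc0.
by apply: le_trans (le_normcD _ _) _; rewrite lerD2l.
Qed.

Lemma cis0 (R : realType) : cis 0 = 1 :> R[i].
Proof. by rewrite /cis cos0 sin0. Qed.

Lemma cisD (R : realType) (a b : R) : cis (a + b) = cis a * cis b.
Proof.
by rewrite /cis cosD sinD; apply/eqP; rewrite eq_complex/=;
   apply/andP; split; apply/eqP; ring.
Qed.

Lemma cis_sum (R : realType) (I : Type) (s : seq I) (a : I -> R) :
  cis (\sum_(i <- s) a i) = \prod_(i <- s) cis (a i).
Proof. by elim/big_rec2: _ => [|i y z _ <-]; rewrite ?cis0 ?cisD. Qed.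

Lemma conjc_cis (R : realType) (a : R) : conjc (cis a) = cis (- a).
Proof. by rewrite /cis cosN sinN. Qed.

Lemma normc_cis (R : realType) (a : R) : normc (cis a) = 1.
Proof. by rewrite /= cos2Dsin2 sqrtr1. Qed.

Lemma cis_mul_conj (R : realType) (a : R) : cis a * conjc (cis a) = 1.
Proof. by rewrite conjc_cis -cisD subrr cis0. Qed.

Lemma cis_period (R : realType) (k : int) : cis (2 * pi * k%:~R) = 1 :> R[i].
Proof.
have cis2pi (n : nat) : cis (2 * pi * n%:R) = 1 :> R[i].
  elim: n => [|n IHn]; first by rewrite mulr0 cis0.
  rewrite -[n.+1%:R]natr1 mulrDr cisD IHn mul1r mulr1 mulr_natl.
  by rewrite /cis cos2pi sin2pi.
case: k => n; first exact: cis2pi.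
by rewrite NegzE mulrNz mulrN -conjc_cis (cis2pi n.+1) conjc1.
Qed.

Lemma normc_cis_sub1 (R : realType) (a : R) :
  normc (cis a - 1) = 2 * `|sin (a / 2)|.
Proof.
apply/eqP; rewrite -(@eqrXn2 _ 2) ?normc_ge0 ?mulr_ge0//.
rewrite normc_sqr exprMn real_normK ?num_real//=.
have := cos2Dsin2 a; have := one_sub_cosE a.
rewrite oppr0 addr0 !expr2 => e1 e2.
by apply/eqP; nra.
Qed.

Lemma normc_cis_sub_le (R : realType) (a b : R) :
  normc (cis a - cis b) <= `|a - b|.
Proof.
have -> : cis a - cis b = cis b * (cis (a - b) - 1).
  by rewrite mulrBr mulr1 -cisD [b + _]addrC subrK.
rewrite ComplexField.Normc.normcM normc_cis mul1r normc_cis_sub1.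
by have := norm_sin_le ((a - b) / 2); rewrite normrM [`|2^-1|]ger0_norm//; lra.
Qed.

Lemma cis_neq1 (R : realType) (a : R) : 0 < `|a| < 2 * pi -> cis a != 1.
Proof.
case/andP => a0 a2; apply/eqP => a1.
have : normc (cis a - 1) = 0 by rewrite a1 subrr ComplexField.Normc.normc0.
rewrite normc_cis_sub1 => /eqP; rewrite mulf_eq0 normr_eq0 pnatr_eq0/=.
apply/negP; have [sg|sg] := leP 0 a.
  by rewrite gt_eqF// sin_gt0_pi//; move: a0 a2; rewrite ger0_norm//; lra.
rewrite -[a]opprK mulNr sinN oppr_eq0.
by rewrite gt_eqF// sin_gt0_pi//; move: a0 a2; rewrite ltr0_norm//; lra.
Qed.

(** * Finite Fourier analysis *)

Lemma parseval_finite (R : realType) (G : finType) (I : eqType) (s : seq I)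
    (e : I -> G -> R[i]) (a : I -> R[i]) (M : R) :
  uniq s ->
  (forall h k, h \in s -> k \in s ->
     \sum_x e h x * conjc (e k x) = ((h == k)%:R * M)%:C%C) ->
  \sum_x normc (\sum_(h <- s) a h * e h x) ^+ 2 =
  M * \sum_(h <- s) normc (a h) ^+ 2.
Proof.
move=> us orth; apply: (@complexI R).
rewrite rmorphM !rmorph_sum /=.
under eq_bigr => x _.
  rewrite normc_sqrE rmorph_sum mulr_suml.
  under eq_bigr do rewrite mulr_sumr; over.
rewrite exchange_big mulr_sumr /=; apply: eq_big_seq => h hs.
rewrite exchange_big /= (bigD1_seq h)//= [X in _ + X]big1_seq ?addr0.
  under eq_bigr do rewrite rmorphM/= mulrACA.
  by rewrite -mulr_sumr orth// eqxx mul1r normc_sqrE mulrC.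
move=> k /andP[kh ks].
under eq_bigr do rewrite rmorphM/= mulrACA.
by rewrite -mulr_sumr orth// eq_sym (negPf kh) mul0r mulr0.
Qed.

(** The sum of a nontrivial character vanishes because translating the
    variable multiplies it by a constant different from 1. *)
Lemma sum_character_eq0 (R : realType) (G : finType) (tau : G -> G)
    (f : G -> R[i]) (u : R[i]) :
  injective tau -> u != 1 -> (forall x, f (tau x) = u * f x) ->
  \sum_x f x = 0.
Proof.
move=> tau_inj u1 ftau; apply/eqP.
have : (1 - u) * \sum_x f x = 0.
  rewrite mulrBl mul1r {1}(reindex_inj tau_inj) mulr_sumr.
  by rewrite -sumrB big1// => x _; rewrite ftau subrr.
by move/eqP; rewrite mulf_eq0 subr_eq0 eq_sym (negPf u1).
Qed.

(** The [k]-th character of Z/(n+2)Z; the sign in the exponent is that of the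
    Fourier coefficients. *)
Definition zchar (R : realType) (n : nat) (k : int) (t : 'Z_n.+2) : R[i] :=
  cis (- (2 * pi * (k%:~R * ((t : nat)%:R / n.+2%:R)))).

Lemma zcharDl (R : realType) n (k l : int) (t : 'Z_n.+2) :
  zchar R (k + l) t = zchar R k t * zchar R l t.
Proof.
by rewrite /zchar -cisD; congr cis; rewrite intrD; ring.
Qed.

Lemma zchar0 (R : realType) n (t : 'Z_n.+2) : zchar R 0 t = 1.
Proof. by rewrite /zchar mul0r mulr0 oppr0 cis0. Qed.

Lemma zcharN (R : realType) n (k : int) (t : 'Z_n.+2) :
  zchar R (- k) t = conjc (zchar R k t).
Proof. by rewrite /zchar conjc_cis rmorphN/= mulNr mulrN. Qed.

Lemma zcharDr (R : realType) n (k : int) (s t : 'Z_n.+2) :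
  zchar R k (s + t) = zchar R k s * zchar R k t.
Proof.
rewrite /zchar -cisD.
have N0 : n.+2%:R != 0 :> R by rewrite pnatr_eq0.
have vst : ((s + t)%R : nat) = ((s + t) %% n.+2)%N by [].
pose q := ((s + t) %/ n.+2)%N.
have stE : s%:R + t%:R = q%:R * n.+2%:R + ((s + t)%R : nat)%:R :> R.
  by rewrite vst -natrD -natrM -natrD -divn_eq.
have := cis_period R (- (k * q%:Z)) => c1.
rewrite -[LHS]mul1r -c1 -cisD; congr cis.
rewrite rmorphN rmorphM/= -pmulrn.
have -> : ((s + t)%R : nat)%:R = s%:R + t%:R - q%:R * n.+2%:R :> R.
  by rewrite stE addrAC subrr add0r.
by field.
Qed.

Lemma zcharB (R : realType) n (k : int) (s t : 'Z_n.+2) :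
  zchar R k (s - t) = zchar R k s * conjc (zchar R k t).
Proof.
have e1 : zchar R k (s - t) * zchar R k t = zchar R k s.
  by rewrite -zcharDr subrK.
by rewrite -e1 -mulrA cis_mul_conj mulr1.
Qed.

Lemma val_Zp1 n : (1%R : 'Z_n.+2) = 1%N :> nat.
Proof. by []. Qed.

Lemma zchar_gen_neq1 (R : realType) n (k : int) :
  (0 < `|k| < n.+2)%N -> zchar R k (1 : 'Z_n.+2) != 1.
Proof.
move=> /andP[k0 kN]; apply: cis_neq1; rewrite normrN.
have p0 := @pi_gt0 R.
rewrite val_Zp1 !normrM !(ger0_norm (ltW p0)) [`|2|]ger0_norm//.
rewrite normr1 mul1r [`|_^-1|]ger0_norm ?invr_ge0// -intr_norm -abszE.
rewrite -pmulrn; apply/andP; split.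
  by rewrite !mulr_gt0// ?invr_gt0 ltr0n.
by rewrite -[ltRHS]mulr1 ltr_pM2l ?mulr_gt0// ltr_pdivrMr ?mul1r ?ltr_nat ?ltr0n.
Qed.

Lemma zchar_orthogonal (R : realType) n (k l : int) :
  (`|k - l| < n.+2)%N ->
  \sum_(t : 'Z_n.+2) zchar R k t * conjc (zchar R l t) =
  ((k == l)%:R * n.+2%:R)%:C%C.
Proof.
move=> klN; under eq_bigr do rewrite -zcharN -zcharDl.
have [->|kl] := eqVneq k l.
  under eq_bigr do rewrite subrr zchar0.
  by rewrite sumr_const card_ord mul1r rmorph_nat.
rewrite mul0r.
apply: (@sum_character_eq0 _ 'Z_n.+2 (fun t => 1 + t) _ (@zchar R n (k - l) 1)).
- exact: addrI.
- by apply: zchar_gen_neq1; rewrite klN absz_gt0 subr_eq0 kl.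
- by move=> t; exact: zcharDr.
Qed.

(** * The smoothing kernel on Z/NZ *)

(** The lowest Dirichlet eigenfunction of the segment {0, ..., H+1}. *)
Definition fk_coef (R : realType) (H m : nat) : R :=
  sin (pi * m%:R / H.+1%:R).

Definition fk_mass (R : realType) (H : nat) : R :=
  \sum_(m < H) fk_coef R H m.+1 ^+ 2.

Definition fk_poly (R : realType) (n H : nat) (t : 'Z_n.+2) : R[i] :=
  \sum_(m < H) (fk_coef R H m.+1)%:C%C * zchar R m t.

(** The Fejer-Korovkin kernel, normalized to total mass 1. *)
Definition fk_weight (R : realType) (n H : nat) (t : 'Z_n.+2) : R :=
  normc (fk_poly R H t) ^+ 2 / (n.+2%:R * fk_mass R H).

Lemma fk_coef0 (R : realType) H : fk_coef R H 0 = 0.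
Proof. by rewrite /fk_coef mulr0 mul0r sin0. Qed.

Lemma fk_coef_last (R : realType) H : fk_coef R H H.+1 = 0.
Proof. by rewrite /fk_coef mulfK ?sinpi// pnatr_eq0. Qed.

Lemma fk_coef_rec (R : realType) H m :
  fk_coef R H m.+2 + fk_coef R H m =
  2 * cos (pi / H.+1%:R) * fk_coef R H m.+1.
Proof.
rewrite /fk_coef; set u := pi * _ / _; set v := pi * m%:R / _.
set w := pi * m.+1%:R / _; set th := pi / _.
have H0 : H.+1%:R != 0 :> R by rewrite pnatr_eq0.
have -> : u = w + th by rewrite /u /w /th; field.
have -> : v = w - th by rewrite /v /w /th; field.
by rewrite sinD sinB; ring.
Qed.

Lemma fk_mass_gt0 (R : realType) H : (0 < H)%N -> 0 < fk_mass R H.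
Proof.
case: H => // H _; rewrite /fk_mass big_ord_recl ltr_wpDr//.
  by apply: sumr_ge0 => i _; exact: sqr_ge0.
rewrite exprn_gt0// sin_gt0_pi// mulr1; have p0 := @pi_gt0 R.
by rewrite divr_gt0//= ltr_pdivrMr// -[ltLHS]mulr1 ltr_pM2l// ltr1n.
Qed.

(** The coefficients are an eigenvector of the discrete Laplacian with
    Dirichlet boundary conditions, which makes this quadratic form explicit. *)
Lemma fk_coef_energy (R : realType) H :
  \sum_(m < H.+1) (fk_coef R H m - fk_coef R H m.+1) ^+ 2 =
  (2 - 2 * cos (pi / H.+1%:R)) * fk_mass R H.
Proof.
set a := fk_coef R H; set th := pi / _.
have S1 : \sum_(m < H.+1) a m ^+ 2 = fk_mass R H.
  by rewrite big_ord_recl /a fk_coef0 expr0n add0r.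
have S2 : \sum_(m < H.+1) a m.+1 ^+ 2 = fk_mass R H.
  by rewrite big_ord_recr /= /a fk_coef_last expr0n addr0.
have T : \sum_(m < H.+1) a m.+1 * a m.+2 = \sum_(m < H.+1) a m * a m.+1.
  rewrite [RHS]big_ord_recl /= [X in X * _](_ : a 0%N = 0) ?/a ?fk_coef0//.
  by rewrite mul0r add0r big_ord_recr/= fk_coef_last mul0r addr0.
have C : \sum_(m < H.+1) a m.+1 * a m.+2 + \sum_(m < H.+1) a m * a m.+1 =
    2 * cos th * fk_mass R H.
  rewrite -big_split -S2 mulr_sumr; apply: eq_bigr => m _ /=.
  by rewrite expr2 mulrA -fk_coef_rec -/a; ring.
have -> : \sum_(m < H.+1) (a m - a m.+1) ^+ 2 =
    \sum_(m < H.+1) a m ^+ 2 + \sum_(m < H.+1) a m.+1 ^+ 2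
    - 2 * \sum_(m < H.+1) a m * a m.+1.
  by rewrite mulr_sumr -big_split -sumrB; apply: eq_bigr => m _ /=; ring.
by rewrite S1 S2; move: C; rewrite T; lra.
Qed.

Lemma zchar_ord_orthogonal (R : realType) n m (k l : 'I_m) : (m <= n.+2)%N ->
  \sum_(t : 'Z_n.+2) zchar R k t * conjc (zchar R l t) =
  ((k == l)%:R * n.+2%:R)%:C%C.
Proof.
move=> mn; rewrite zchar_orthogonal//.
by have := ltn_ord k; have := ltn_ord l; lia.
Qed.

Lemma fk_weight_ge0 (R : realType) n H (t : 'Z_n.+2) : 0 <= fk_weight R H t.
Proof.
rewrite divr_ge0 ?sqr_ge0// mulr_ge0// sumr_ge0// => m _; exact: sqr_ge0.
Qed.

Lemma sum_fk_weight (R : realType) n H : (0 < H < n.+2)%N ->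
  \sum_(t : 'Z_n.+2) fk_weight R H t = 1.
Proof.
move=> /andP[H0 Hn]; rewrite -mulr_suml.
rewrite (@parseval_finite _ _ _ _ (fun m : 'I_H => @zchar R n m)
  (fun m => (fk_coef R H m.+1)%:C%C) n.+2%:R) ?index_enum_uniq//; last first.
  by move=> k l _ _; apply: zchar_ord_orthogonal; exact: ltnW.
under eq_bigr do rewrite normc_real real_normK ?num_real//.
by rewrite mulfV// mulf_neq0 ?pnatr_eq0// gt_eqF// fk_mass_gt0.
Qed.

Lemma fk_polyM (R : realType) n H (t : 'Z_n.+2) :
  fk_poly R H t * (zchar R 1 t - 1) =
  \sum_(m < H.+1) (fk_coef R H m - fk_coef R H m.+1)%:C%C * zchar R m t.
Proof.
have -> : \sum_(m < H.+1)
    (fk_coef R H m - fk_coef R H m.+1)%:C%C * zchar R m t =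
  \sum_(m < H.+1) (fk_coef R H m)%:C%C * zchar R m t -
  \sum_(m < H.+1) (fk_coef R H m.+1)%:C%C * zchar R m t.
  by rewrite -sumrB; apply: eq_bigr => m _; rewrite rmorphB mulrBl.
rewrite big_ord_recl fk_coef0 rmorph0 mul0r add0r.
rewrite [X in _ = _ - X]big_ord_recr/= fk_coef_last rmorph0 mul0r addr0.
rewrite mulrBr mulr1 mulr_suml; congr (_ - _); apply: eq_bigr => m _.
by rewrite -mulrA -zcharDl /bump/= add1n -addn1 PoszD.
Qed.

(** Multiplication by [zchar R 1 t - 1] takes differences of the coefficients
    of [fk_poly], so Parseval turns this second moment into the Rayleigh
    quotient of the coefficients, which is the lowest eigenvalue. *)
Lemma sum_fk_weight_chord (R : realType) n H : (0 < H < n.+2)%N ->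
  \sum_(t : 'Z_n.+2) fk_weight R H t * normc (zchar R 1 t - 1) ^+ 2 =
  2 - 2 * cos (pi / H.+1%:R).
Proof.
move=> /andP[H0 Hn].
under eq_bigr do rewrite mulrAC -exprMn -ComplexField.Normc.normcM fk_polyM.
rewrite -mulr_suml (@parseval_finite _ _ _ _ (fun m : 'I_H.+1 => @zchar R n m)
  (fun m => (fk_coef R H m - fk_coef R H m.+1)%:C%C) n.+2%:R)
  ?index_enum_uniq//; last first.
  by move=> k l _ _; exact: zchar_ord_orthogonal.
under eq_bigr do rewrite normc_real real_normK ?num_real//.
rewrite fk_coef_energy; field.
by rewrite -natrD pnatr_eq0 gt_eqF// fk_mass_gt0.
Qed.

(** Distance to 0 on the cycle Z/(n+2)Z. *)
Definition znorm (n : nat) (t : 'Z_n.+2) : nat := minn t (n.+2 - t).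

(** On the unit circle, a chord has at least half the length of the shorter arc
    that it spans. *)
Lemma znorm_chord (R : realType) n (t : 'Z_n.+2) :
  pi * ((znorm t)%:R / n.+2%:R) <= normc (zchar R 1 t - 1).
Proof.
have p0 := @pi_gt0 R.
have N0 : 0 < n.+2%:R :> R by rewrite ltr0n.
have tN : (t < n.+2)%N by exact: ltn_ord.
set u := pi * _.
have u0 : 0 <= u by rewrite mulr_ge0 ?divr_ge0// ltW.
have u2 : u <= pi / 2.
  rewrite /u ler_pM2l// ler_pdivrMr// mulrC ler_pdivlMr// -natrM ler_nat.
  by rewrite /znorm; lia.
have -> : normc (zchar R 1 t - 1) = 2 * sin u.
  rewrite normc_cis_sub1 mul1r !mulNr sinN normrN; congr (2 * _).
  rewrite -(@ger0_norm _ (sin u)); last by rewrite sin_ge0_pi// u0/=; lra.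
  rewrite /u /znorm; case: leqP => _; first by congr `|sin _|; field; lra.
  rewrite natrB; last exact: ltnW.
  have -> : pi * ((n.+2%:R - t%:R) / n.+2%:R) = pi - 2 * pi * (t%:R / n.+2%:R) / 2
    :> R by field; lra.
  by rewrite sinB sinpi cospi mul0r sub0r mulN1r opprK.
(* Here u is half the arc, and
   sin u = 2 sin (u/2) cos (u/2) >= u cos (u/2)^2 >= u/2 on [0, pi/2] *)
have c0 : 0 <= cos u by rewrite cos_ge0_pihalf// u2 andbT; lra.
have ch : cos u = 2 * cos (u / 2) ^+ 2 - 1.
  have {1}-> : u = (u / 2) *+ 2 by rewrite mulr2n; lra.
  by rewrite cos_mulr2n -mulr_natl.
have sh : sin u = 2 * (cos (u / 2) * sin (u / 2)).
  have {1}-> : u = (u / 2) *+ 2 by rewrite mulr2n; lra.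
  by rewrite sin_mulr2n -mulr_natl.
have s1 : u / 2 * cos (u / 2) <= sin (u / 2) by apply: mulr_cos_le_sin; lra.
have ch0 : 0 <= cos (u / 2) by apply: cos_ge0_pihalf; lra.
have := ler_wpM2l ch0 s1; nra.
Qed.

Lemma sum_fk_weight_znorm (R : realType) n H : (0 < H < n.+2)%N ->
  \sum_(t : 'Z_n.+2) fk_weight R H t * ((znorm t)%:R / n.+2%:R) <= H.+1%:R^-1.
Proof.
move=> Hn; have p0 := @pi_gt0 R.
pose z t : R := (znorm (t : 'Z_n.+2))%:R / n.+2%:R.
have H0 : 0 < H.+1%:R :> R by rewrite ltr0n.
have z2 : \sum_(t : 'Z_n.+2) fk_weight R H t * z t ^+ 2 <= H.+1%:R^-1 ^+ 2.
  rewrite -(@ler_pM2l _ (pi ^+ 2)) ?exprn_gt0// -exprMn.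
  apply: le_trans (one_sub_cos_le _).
  rewrite -(sum_fk_weight_chord R Hn) mulr_sumr; apply: ler_sum => t _.
  rewrite mulrCA ler_wpM2l ?fk_weight_ge0// -exprMn ler_sqr ?nnegrE ?normc_ge0//.
    exact: znorm_chord.
  by rewrite mulr_ge0 ?divr_ge0// ltW.
(* z <= (H+1)/2 z^2 + 1/(2(H+1)) reduces the first moment to the second. *)
have amgm t : fk_weight R H t * z t <= fk_weight R H t *
    (H.+1%:R / 2 * z t ^+ 2 + H.+1%:R^-1 / 2).
  rewrite ler_wpM2l ?fk_weight_ge0// -subr_ge0.
  have -> : H.+1%:R / 2 * z t ^+ 2 + H.+1%:R^-1 / 2 - z t =
      H.+1%:R / 2 * (z t - H.+1%:R^-1) ^+ 2 by field; lra.
  by rewrite mulr_ge0 ?sqr_ge0// divr_ge0.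
apply: (le_trans (ler_sum _ (fun t _ => amgm t))).
have -> : \sum_(t : 'Z_n.+2) fk_weight R H t *
    (H.+1%:R / 2 * z t ^+ 2 + H.+1%:R^-1 / 2) =
    H.+1%:R / 2 * (\sum_(t : 'Z_n.+2) fk_weight R H t * z t ^+ 2)
    + H.+1%:R^-1 / 2 * \sum_(t : 'Z_n.+2) fk_weight R H t.
  by rewrite !mulr_sumr -big_split; apply: eq_bigr => t _ /=; ring.
rewrite sum_fk_weight// mulr1.
apply: (@le_trans _ _ (H.+1%:R / 2 * H.+1%:R^-1 ^+ 2 + H.+1%:R^-1 / 2)).
  by rewrite lerD2r ler_wpM2l// divr_ge0.
rewrite le_eqVlt; apply/orP; left; apply/eqP; field; lra.
Qed.

(** * Smoothing on the grid (Z/NZ)^d *)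

Definition grid (d n : nat) : Type := {ffun 'I_d -> 'Z_n.+2}.

HB.instance Definition _ d n := Finite.on (grid d n).
HB.instance Definition _ d n := GRing.Zmodule.on (grid d n).

Definition gchar (R : realType) d n (h : 'rV[int]_d) (x : grid d n) : R[i] :=
  \prod_(j < d) zchar R (h ord0 j) (x j).

Definition gweight (R : realType) d n (H : nat) (x : grid d n) : R :=
  \prod_(j < d) fk_weight R H (x j).

Definition smooth (R : realType) d n (H : nat) (f : grid d n -> R)
    (x : grid d n) : R :=
  \sum_(y : grid d n) gweight R H (x - y) * f y.

Definition gdist (R : realType) d n (x y : grid d n) : R :=
  \sum_(j < d) (znorm (x j - y j))%:R / n.+2%:R.

Definition gunit d n (j : 'I_d) : grid d n := [ffun i => (i == j)%:R].

Lemma znorm0 n : znorm (0 : 'Z_n.+2) = 0%N.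
Proof. by rewrite /znorm min0n. Qed.

Lemma znorm1 n : znorm (1 : 'Z_n.+2) = 1%N.
Proof. by rewrite /znorm val_Zp1; lia. Qed.

Lemma val_ZpD n (s t : 'Z_n.+2) : ((s + t)%R : nat) =
  (if (s + t < n.+2) then s + t else s + t - n.+2)%N.
Proof.
have sN : (s < n.+2)%N by exact: ltn_ord.
have tN : (t < n.+2)%N by exact: ltn_ord.
have -> : ((s + t)%R : nat) = ((s + t) %% n.+2)%N by [].
case: ltnP => st; first by rewrite modn_small.
rewrite -{1}(subnK st) modnDr modn_small//; lia.
Qed.

Lemma znormD n (s t : 'Z_n.+2) : (znorm (s + t)%R <= znorm s + znorm t)%N.
Proof.
have sN : (s < n.+2)%N by exact: ltn_ord.
have tN : (t < n.+2)%N by exact: ltn_ord.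
by rewrite /znorm val_ZpD; case: ifP; lia.
Qed.

Lemma znormN n (t : 'Z_n.+2) : znorm (- t) = znorm t.
Proof.
have tN : (t < n.+2)%N by exact: ltn_ord.
have ntN : ((- t)%R < n.+2)%N by exact: ltn_ord.
have := val_ZpD t (- t); rewrite subrr /znorm => /esym.
have -> : ((0%R : 'Z_n.+2) : nat) = 0%N by [].
by case: ifP; lia.
Qed.

Lemma gdistxx (R : realType) d n (x : grid d n) : gdist R x x = 0.
Proof. by rewrite /gdist big1// => j _; rewrite subrr znorm0 mul0r. Qed.

Lemma gdist_triangle (R : realType) d n (x y z : grid d n) :
  gdist R x z <= gdist R x y + gdist R y z.
Proof.
rewrite /gdist -big_split; apply: ler_sum => j _ /=.
rewrite -mulrDl ler_wpM2r ?invr_ge0// -natrD ler_nat.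
by rewrite -(subrKA (y j)) znormD.
Qed.

Lemma gdistC (R : realType) d n (x y : grid d n) : gdist R x y = gdist R y x.
Proof. by apply: eq_bigr => j _; rewrite -znormN opprB. Qed.

Lemma gweight_ge0 (R : realType) d n H (x : grid d n) : 0 <= gweight R H x.
Proof. by apply: prodr_ge0 => j _; exact: fk_weight_ge0. Qed.

Lemma sum_gweight (R : realType) d n H : (0 < H < n.+2)%N ->
  \sum_(x : grid d n) gweight R H x = 1.
Proof.
move=> Hn; rewrite -(bigA_distr_bigA (fun _ t => fk_weight R H t)).
by rewrite big1// => j _; rewrite sum_fk_weight.
Qed.

Lemma sum_gweight_znorm (R : realType) d n H (j : 'I_d) : (0 < H < n.+2)%N ->
  \sum_(x : grid d n) gweight R H x * ((znorm (x j))%:R / n.+2%:R)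
  <= H.+1%:R^-1.
Proof.
move=> Hn; pose z (t : 'Z_n.+2) : R := (znorm t)%:R / n.+2%:R.
pose F (i : 'I_d) (t : 'Z_n.+2) : R :=
  fk_weight R H t * (if i == j then z t else 1).
have -> : \sum_(x : grid d n) gweight R H x * z (x j) =
    \sum_(x : grid d n) \prod_i F i (x i).
  apply: eq_bigr => x _; rewrite /F big_split/=; congr (_ * _).
  rewrite (bigD1 j)//= eqxx big1 ?mulr1// => i /negPf -> //.
rewrite -bigA_distr_bigA (bigD1 j)//= [X in _ * X]big1 ?mulr1.
  rewrite /F eqxx; exact: sum_fk_weight_znorm.
move=> i /negPf ij; rewrite /F ij; under eq_bigr do rewrite mulr1.
by rewrite sum_fk_weight.
Qed.

Lemma smoothE (R : realType) d n H (f : grid d n -> R) (x : grid d n) :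
  smooth H f x = \sum_(y : grid d n) gweight R H y * f (x - y).
Proof.
rewrite /smooth (reindex_inj (h := fun y => x - y)) /=.
  by apply: eq_bigr => y _; rewrite opprB addrC subrK.
by move=> a b /addrI/oppr_inj.
Qed.

(** The value at [x] is compared with an average of values at points [x - y];
    the distance being a sum over coordinates, only the marginals of the kernel
    matter. *)
Lemma smooth_approx (R : realType) d n H (L : R) (f : grid d n -> R) x :
  (0 < H < n.+2)%N -> 0 <= L -> (forall x y, f x - f y <= L * gdist R x y) ->
  `|f x - smooth H f x| <= L * (d%:R / H.+1%:R).
Proof.
move=> Hn L0 fL.
have -> : f x - smooth H f x =
    \sum_(y : grid d n) gweight R H y * (f x - f (x - y)).
  under eq_bigr do rewrite mulrBr.
  by rewrite sumrB -mulr_suml sum_gweight// mul1r smoothE.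
apply: le_trans (ler_norm_sum _ _ _) _.
apply: (@le_trans _ _ (\sum_(y : grid d n) gweight R H y *
    (L * \sum_(j < d) (znorm (y j))%:R / n.+2%:R))).
  apply: ler_sum => y _; rewrite normrM ger0_norm ?gweight_ge0//.
  rewrite ler_wpM2l ?gweight_ge0//.
  have -> : \sum_(j < d) (znorm (y j))%:R / n.+2%:R = gdist R x (x - y).
    by apply: eq_bigr => j _; rewrite !ffunE opprB addrC subrK.
  by rewrite ler_norml fL andbT lerNl opprB gdistC fL.
under eq_bigr do rewrite mulrCA mulr_sumr.
rewrite -mulr_sumr ler_wpM2l// exchange_big /=.
apply: (le_trans (ler_sum _ (fun j _ => sum_gweight_znorm R j Hn))).
by rewrite sumr_const card_ord mulr_natl.
Qed.

(** Convolution averages translates of [f], all of which are Lipschitz. *)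
Lemma smooth_increment (R : realType) d n H (L : R) (f : grid d n -> R) j x :
  (0 < H < n.+2)%N -> 0 <= L -> (forall x y, f x - f y <= L * gdist R x y) ->
  `|smooth H f (x + gunit n j) - smooth H f x| <= L / n.+2%:R.
Proof.
move=> Hn L0 fL; rewrite !smoothE -sumrB.
apply: le_trans (ler_norm_sum _ _ _) _.
have du a : gdist R (a + gunit n j) a = n.+2%:R^-1.
  rewrite /gdist (bigD1 j)//= big1 => [|i /negPf ij]; rewrite !ffunE.
    by rewrite [a j + _]addrC addrK eqxx znorm1 mul1r addr0.
  by rewrite [a i + _]addrC addrK ij znorm0 mul0r.
have -> : L / n.+2%:R =
    \sum_(y : grid d n) gweight R H y * (L / n.+2%:R).
  by rewrite -mulr_suml sum_gweight// mul1r.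
apply: ler_sum => y _; rewrite -mulrBr normrM ger0_norm ?gweight_ge0//.
rewrite ler_wpM2l ?gweight_ge0//.
rewrite addrAC -(du (x - y)) ler_norml fL andbT lerNl opprB gdistC fL.
by [].
Qed.

(** The kernel is the squared modulus of a polynomial with frequencies
    [0 .. H-1], hence a combination of characters of frequencies in (-H, H). *)
Lemma fk_weight_span (R : realType) n H (s t : 'Z_n.+2) :
  (fk_weight R H (s - t))%:C%C = \sum_(m : 'I_H * 'I_H)
    (fk_coef R H m.1.+1 * fk_coef R H m.2.+1 / (n.+2%:R * fk_mass R H))%:C%C *
    zchar R (m.1%:Z - m.2%:Z) s * conjc (zchar R (m.1%:Z - m.2%:Z) t).
Proof.
have conjE : conjc (fk_poly R H (s - t)) =
    \sum_(m < H) (fk_coef R H m.+1)%:C%C * zchar R (- m%:Z) (s - t).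
  rewrite /fk_poly rmorph_sum; apply: eq_bigr => m _.
  by rewrite rmorphM zcharN; congr (_ * _); exact: conjc_real.
rewrite /fk_weight realcM normc_sqrE conjE /fk_poly !mulr_suml.
rewrite -(pair_bigA _ (fun m1 m2 : 'I_H =>
   (fk_coef R H m1.+1 * fk_coef R H m2.+1 / (n.+2%:R * fk_mass R H))%:C%C *
    zchar R (m1%:Z - m2%:Z) s * conjc (zchar R (m1%:Z - m2%:Z) t))).
apply: eq_bigr => k _; rewrite mulr_sumr mulr_suml; apply: eq_bigr => l _.
rewrite -[in RHS]mulrA -zcharB zcharDl !realcM.
ring.
Qed.

(** Characters separate the variables of the kernel [gweight R H (x - y)], which
    leaves a trigonometric polynomial in [x].  Several index tuples give the same
    frequency, and the coefficients are collected accordingly. *)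
Lemma smooth_span (R : realType) d n H (f : grid d n -> R)
    (s : seq 'rV[int]_d) :
  uniq s -> (forall h : 'rV_d, (forall j, `|h ord0 j| < H)%N -> h \in s) ->
  exists c : 'rV[int]_d -> R[i],
    forall x, (smooth H f x)%:C%C = \sum_(h <- s) c h * gchar R h x.
Proof.
move=> us sH.
pose fr (p : {ffun 'I_d -> 'I_H * 'I_H}) : 'rV[int]_d :=
  \row_j ((p j).1%:Z - (p j).2%:Z).
pose b (m : 'I_H * 'I_H) : R[i] :=
  (fk_coef R H m.1.+1 * fk_coef R H m.2.+1 / (n.+2%:R * fk_mass R H))%:C%C.
pose D (p : {ffun 'I_d -> 'I_H * 'I_H}) := \sum_(y : grid d n)
  (\prod_j b (p j)) * conjc (gchar R (fr p) y) * (f y)%:C%C.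
exists (fun h => \sum_(p | fr p == h) D p) => x.
transitivity (\sum_p D p * gchar R (fr p) x).
  rewrite /smooth realc_sum; under [RHS]eq_bigr do rewrite mulr_suml.
  rewrite exchange_big; apply: eq_bigr => y _.
  rewrite realcM /gweight realc_prod.
  under eq_bigr do rewrite !ffunE fk_weight_span.
  rewrite bigA_distr_bigA mulr_suml; apply: eq_bigr => p _.
  have frE (z : grid d n) : gchar R (fr p) z =
      \prod_j zchar R ((p j).1%:Z - (p j).2%:Z) (z j).
    by apply: eq_bigr => j _; rewrite mxE.
  have conjE : conjc (gchar R (fr p) y) =
      \prod_j conjc (zchar R ((p j).1%:Z - (p j).2%:Z) (y j)).
    by rewrite frE rmorph_prod.
  rewrite conjE (frE x) [RHS]mulrAC; congr (_ * _).
  by rewrite [RHS]mulrAC -!big_split.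
under [RHS]eq_bigr do rewrite mulr_suml.
rewrite (exchange_big_dep xpredT)//=; apply: eq_bigr => p _.
rewrite (big_rem (fr p))/=; last first.
  apply: sH => j; rewrite mxE.
  by have := ltn_ord (p j).1; have := ltn_ord (p j).2; lia.
rewrite eqxx big1_seq ?addr0// => h /andP[/eqP<-].
by rewrite rem_filter// mem_filter/= eqxx.
Qed.

(** * Test functions against differences of measures on the grid *)

Lemma cauchy_schwarz_sum (R : rcfType) (I : Type) (s : seq I) (a b : I -> R) :
  \sum_(i <- s) a i * b i <=
  Num.sqrt (\sum_(i <- s) a i ^+ 2) * Num.sqrt (\sum_(i <- s) b i ^+ 2).
Proof.
have sq0 (f : I -> R) : 0 <= \sum_(i <- s) f i ^+ 2.
  by apply: sumr_ge0 => i _; exact: sqr_ge0.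
rewrite -sqrtrM// (le_trans (ler_norm _))// -sqrtr_sqr ler_wsqrtr//.
have : 0 <= \sum_(i <- s) \sum_(j <- s) (a i * b j - a j * b i) ^+ 2.
  by apply: sumr_ge0 => i _; apply: sumr_ge0 => j _; exact: sqr_ge0.
have -> : \sum_(i <- s) \sum_(j <- s) (a i * b j - a j * b i) ^+ 2 =
    2 * ((\sum_(i <- s) a i ^+ 2) * (\sum_(i <- s) b i ^+ 2)) -
    2 * (\sum_(i <- s) a i * b i) ^+ 2.
  have dbl (f g : I -> R) : (\sum_(i <- s) f i) * (\sum_(j <- s) g j) =
      \sum_(i <- s) \sum_(j <- s) f i * g j.
    by rewrite mulr_suml; apply: eq_bigr => i _; rewrite mulr_sumr.
  have e1 := dbl (fun i => a i ^+ 2) (fun i => b i ^+ 2).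
  have e2 := dbl (fun i => b i ^+ 2) (fun i => a i ^+ 2).
  have e3 := dbl (fun i => a i * b i) (fun i => a i * b i).
  transitivity (\sum_(i <- s) \sum_(j <- s) a i ^+ 2 * b j ^+ 2
      + \sum_(i <- s) \sum_(j <- s) b i ^+ 2 * a j ^+ 2
      - 2 * \sum_(i <- s) \sum_(j <- s) a i * b i * (a j * b j)).
    rewrite mulr_sumr -big_split -sumrB; apply: eq_bigr => i _ /=.
    rewrite mulr_sumr -big_split -sumrB; apply: eq_bigr => j _ /=.
    by ring.
  by rewrite -e1 -e2 -e3; ring.
by rewrite subr_ge0 ler_pM2l.
Qed.

Lemma gchar_orthogonal (R : realType) d n (h k : 'rV[int]_d) :
  (forall j, `|h ord0 j - k ord0 j| < n.+2)%N ->
  \sum_(x : grid d n) gchar R h x * conjc (gchar R k x) =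
  ((h == k)%:R * #|{: grid d n}|%:R)%:C%C.
Proof.
move=> hk.
have -> : \sum_(x : grid d n) gchar R h x * conjc (gchar R k x) =
    \sum_(x : grid d n) \prod_j
      (zchar R (h ord0 j) (x j) * conjc (zchar R (k ord0 j) (x j))).
  by apply: eq_bigr => x _; rewrite /gchar rmorph_prod -big_split.
rewrite -(bigA_distr_bigA (fun j (t : 'Z_n.+2) =>
  zchar R (h ord0 j) t * conjc (zchar R (k ord0 j) t))).
under eq_bigr do rewrite zchar_orthogonal//.
rewrite -realc_prod; congr (_ %:C%C); rewrite big_split/=.
congr (_ * _); last by rewrite prodr_const card_ord card_ffun !card_ord natrX.
have [->|hk'] := eqVneq h k; first by rewrite big1// => j _; rewrite eqxx.
have [j hkj] : exists j, h ord0 j != k ord0 j.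
  apply/existsP; apply: contraNT hk' => /existsPn hk'.
  by apply/eqP/rowP => j; apply/eqP; have := hk' j; rewrite negbK.
by rewrite (bigD1 j)//= (negPf hkj) mul0r.
Qed.

Lemma gcharD_unit (R : realType) d n (h : 'rV[int]_d) (x : grid d n) j :
  gchar R h (x + gunit n j) = gchar R h x * zchar R (h ord0 j) (1 : 'Z_n.+2).
Proof.
rewrite /gchar; under eq_bigr do rewrite !ffunE zcharDr.
rewrite big_split/=; congr (_ * _).
rewrite (bigD1 j)//= eqxx big1 ?mulr1// => i /negPf ->.
by rewrite /zchar mul0r !mulr0 oppr0 cis0.
Qed.

(** The increments of a character of low frequency are nearly as large as
    those of its tangent line. *)
Lemma zchar_chord_ge (R : realType) n H (k : int) :
  (H.*2 <= n.+2)%N -> (`|k| <= H)%N ->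
  2 * pi * cos (pi * (H%:R / n.+2%:R)) * (`|k%:~R| / n.+2%:R) <=
  normc (zchar R k (1 : 'Z_n.+2) - 1).
Proof.
move=> Hn kH; have p0 := @pi_gt0 R.
have N0 : 0 < n.+2%:R :> R by rewrite ltr0n.
rewrite normc_cis_sub1 val_Zp1 mulNr sinN normrN.
set v := pi * (H%:R / _).
pose u : R := pi * (`|k%:~R| / n.+2%:R).
have v2 : v <= pi / 2.
  rewrite /v ler_pM2l// ler_pdivrMr// mulrC ler_pdivlMr// -natrM ler_nat.
  by lia.
have u0 : 0 <= u by rewrite mulr_ge0 ?divr_ge0// ltW.
have uv : u <= v.
  rewrite ler_pM2l// ler_pM2r ?invr_gt0// -intr_norm -abszE -pmulrn.
  by rewrite ler_nat.
have cvu : cos v <= cos u.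
  have [->//|uv'] := eqVneq u v; rewrite ltW// ltr_cos ?in_itv/= ?u0//=; try lra.
have -> : `|sin (2 * pi * (k%:~R * (1 / n.+2%:R)) / 2)| = sin u.
  have su : 0 <= sin u by rewrite sin_ge0_pi// u0/=; lra.
  rewrite -(ger0_norm su) /u; have [k0|k0] := leP 0 (k%:~R : R).
    by rewrite (ger0_norm k0); congr `|sin _|; field; lra.
  by rewrite (ltr0_norm k0) mulNr mulrN sinN normrN; congr `|sin _|; field; lra.
have l1 := ler_wpM2l u0 cvu.
have l2 : u * cos u <= sin u by apply: mulr_cos_le_sin; lra.
have -> : 2 * pi * cos v * (`|k%:~R| / n.+2%:R) = 2 * (u * cos v).
  by rewrite /u; ring.
by lra.
Qed.

Lemma enorm_sqr (R : realType) d (v : 'rV[R]_d) :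
  enorm v ^+ 2 = \sum_(j < d) v ord0 j ^+ 2.
Proof. by rewrite sqr_sqrtr// sumr_ge0// => j _; exact: sqr_ge0. Qed.

Lemma ltn_abszB (a b : int) (m k : nat) :
  (k.*2 <= m)%N -> (`|a| < k)%N -> (`|b| < k)%N -> (`|a - b| < m)%N.
Proof. lia. Qed.

(** Parseval applied to the increments of a trigonometric polynomial: its
    Dirichlet energy is controlled by its Lipschitz constant. *)
Lemma trig_energy (R : realType) d n H (L : R) (g : grid d n -> R)
    (s : seq 'rV[int]_d) (c : 'rV[int]_d -> R[i]) :
  (H.*2 <= n.+2)%N -> uniq s ->
  (forall h j, h \in s -> `|h ord0 j| < H)%N ->
  (forall x, (g x)%:C%C = \sum_(h <- s) c h * gchar R h x) ->
  (forall j x, `|g (x + gunit n j) - g x| <= L / n.+2%:R) ->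
  (2 * pi * cos (pi * (H%:R / n.+2%:R))) ^+ 2 *
    (\sum_(h <- s) normc (c h) ^+ 2 * enorm (Zvec R h) ^+ 2) <= d%:R * L ^+ 2.
Proof.
move=> Hn us sH gE gL; set rho := 2 * pi * _.
have N0 : 0 < n.+2%:R :> R by rewrite ltr0n.
have M0 : 0 < #|{: grid d n}|%:R :> R.
  by rewrite ltr0n; apply/card_gt0P; exists (0 : grid d n).
have rho0 : 0 <= rho.
  have p0 := @pi_gt0 R; apply: mulr_ge0; first by rewrite mulr_ge0// ltW.
  apply: cos_ge0_pihalf; apply/andP; split.
    by rewrite (@le_trans _ _ 0)// ?oppr_le0 ?divr_ge0 ?mulr_ge0 ?divr_ge0// ltW.
  by rewrite ler_pM2l// ler_pdivrMr// mulrC ler_pdivlMr// -natrM ler_nat; lia.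
have energyj j : rho ^+ 2 *
    (\sum_(h <- s) normc (c h) ^+ 2 * (h ord0 j)%:~R ^+ 2) <= L ^+ 2.
  have P := @parseval_finite R (grid d n) _ s (fun h => @gchar R d n h)
    (fun h => c h * (zchar R (h ord0 j) (1 : 'Z_n.+2) - 1))
    #|{: grid d n}|%:R us.
  have {}P : \sum_(x : grid d n) (g (x + gunit n j) - g x) ^+ 2 =
      #|{: grid d n}|%:R * \sum_(h <- s) normc (c h) ^+ 2 *
        normc (zchar R (h ord0 j) (1 : 'Z_n.+2) - 1) ^+ 2.
    under [in RHS]eq_bigr do rewrite -exprMn -ComplexField.Normc.normcM.
    rewrite -P => [|h k hs ks]; last first.
      apply: gchar_orthogonal => i; exact: ltn_abszB Hn (sH h i hs) (sH k i ks).
    apply: eq_bigr => x _; rewrite -[LHS]real_normK ?num_real//; congr (_ ^+ 2).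
    rewrite -normc_real; congr normc.
    have -> : (g (x + gunit n j) - g x)%:C%C =
      (g (x + gunit n j))%:C%C - (g x)%:C%C :> R[i] by exact: rmorphB.
    rewrite !gE -sumrB; apply: eq_bigr => h _.
    by rewrite gcharD_unit; ring.
  have {}P : \sum_(h <- s) normc (c h) ^+ 2 *
        normc (zchar R (h ord0 j) (1 : 'Z_n.+2) - 1) ^+ 2 <=
      (L / n.+2%:R) ^+ 2.
    rewrite -(ler_pM2l M0) -P.
    have -> : #|{: grid d n}|%:R * (L / n.+2%:R) ^+ 2 =
        \sum_(x : grid d n) (L / n.+2%:R) ^+ 2.
      by rewrite sumr_const mulr_natl.
    apply: ler_sum => x _; rewrite -[leLHS]real_normK ?num_real//.
    by rewrite ler_sqr ?nnegrE// (le_trans _ (gL j x)).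
  have -> : L ^+ 2 = n.+2%:R ^+ 2 * (L / n.+2%:R) ^+ 2.
    by rewrite -exprMn mulrC divfK// gt_eqF.
  have {}P := ler_wpM2l (sqr_ge0 (n.+2%:R : R)) P; apply: le_trans P.
  rewrite !mulr_sumr big_seq [leRHS]big_seq; apply: ler_sum => h hs.
  rewrite !(mulrCA _ (normc _ ^+ 2)) ler_wpM2l ?sqr_ge0// -!exprMn.
  rewrite -[leLHS]real_normK ?num_real// normrM (ger0_norm rho0).
  rewrite ler_sqr ?nnegrE ?(mulr_ge0 rho0)//; last by rewrite mulr_ge0 ?normc_ge0.
  rewrite -ler_pdivrMl// mulrC -mulrA.
  by apply: zchar_chord_ge => //; apply: ltnW; exact: sH.
have -> : \sum_(h <- s) normc (c h) ^+ 2 * enorm (Zvec R h) ^+ 2 =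
    \sum_(j < d) \sum_(h <- s) normc (c h) ^+ 2 * (h ord0 j)%:~R ^+ 2.
  rewrite exchange_big; apply: eq_bigr => h _ /=.
  by rewrite enorm_sqr mulr_sumr; apply: eq_bigr => j _; rewrite mxE.
rewrite mulr_sumr; apply: (le_trans (ler_sum _ (fun j _ => energyj j))).
by rewrite sumr_const card_ord mulr_natl.
Qed.

Lemma enorm_Zvec_ge1 (R : realType) d (h : 'rV[int]_d) :
  h != 0 -> 1 <= enorm (Zvec R h).
Proof.
move=> h0; rewrite -ler_sqr ?nnegrE ?sqrtr_ge0// expr1n enorm_sqr.
have [j hj] : exists j, h ord0 j != 0.
  apply/existsP; apply: contraNT h0 => /existsPn h0.
  by apply/eqP/rowP => j; apply/eqP; have := h0 j; rewrite negbK mxE.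
rewrite (bigD1 j)//= ler_wpDr//; first by apply: sumr_ge0 => i _; exact: sqr_ge0.
rewrite mxE -rmorphXn/= -[X in X <= _]/(1%:~R) ler_int.
by rewrite -gtz0_ge1 exprn_even_gt0.
Qed.

(** The Lipschitz bound on [g] bounds its coefficients in the norm dual to the
    one measuring [p - q]. *)
Lemma trig_pairing (R : realType) d n H (L delta : R) (g : grid d n -> R)
    (s : seq 'rV[int]_d) (p q : grid d n -> R) (c u : 'rV[int]_d -> R[i]) :
  (H.*2 < n.+2)%N -> uniq s ->
  (forall h j, h \in s -> `|h ord0 j| < H)%N ->
  (forall x, (g x)%:C%C = \sum_(h <- s) c h * gchar R h x) ->
  0 <= L -> (forall j x, `|g (x + gunit n j) - g x| <= L / n.+2%:R) ->
  \sum_x p x = \sum_x q x -> 0 <= delta ->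
  (forall h, h \in s ->
     normc (\sum_x gchar R h x * (p x - q x)%:C%C - u h) <= delta) ->
  \sum_x g x * (p x - q x) <=
  L * (Num.sqrt d%:R / (2 * pi * cos (pi * (H%:R / n.+2%:R))) *
    (Num.sqrt (\sum_(h <- s | h != 0) normc (u h) ^+ 2 / enorm (Zvec R h) ^+ 2)
     + (size s)%:R * delta)).
Proof.
move=> Hn us sH gE L0 gL pq delta0 udelta; set rho := 2 * pi * _.
have N0 : 0 < n.+2%:R :> R by rewrite ltr0n.
have p0 := @pi_gt0 R.
have rho0 : 0 < rho.
  apply: mulr_gt0; first by rewrite mulr_gt0.
  apply: cos_gt0_pihalf; apply/andP; split.
    by rewrite (@lt_le_trans _ _ 0)// ?oppr_lt0 ?divr_gt0 ?mulr_ge0 ?divr_ge0// ltW.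
  by rewrite ltr_pM2l// ltr_pdivrMr// mulrC ltr_pdivlMr// -natrM ltr_nat; lia.
have en := trig_energy (ltnW Hn) us sH gE gL; rewrite -/rho in en.
set E := \sum_(h <- s) _ in en.
have E0 : 0 <= E.
  by apply: sumr_ge0 => h _; rewrite mulr_ge0 ?sqr_ge0.
have sqrtE : Num.sqrt E <= L * (Num.sqrt d%:R / rho).
  rewrite mulrA ler_pdivlMr// mulrC -(ger0_norm (ltW rho0)) -sqrtr_sqr.
  rewrite -sqrtrM ?sqr_ge0// (le_trans (ler_wsqrtr en))//.
  by rewrite sqrtrM// sqrtr_sqr ger0_norm// mulrC.
pose U h : R[i] := \sum_x gchar R h x * (p x - q x)%:C%C.
have gU : (\sum_x g x * (p x - q x))%:C%C = \sum_(h <- s | h != 0) c h * U h.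
  rewrite realc_sum; under eq_bigr do rewrite realcM gE mulr_suml.
  rewrite exchange_big /= [RHS]big_mkcond /=; apply: eq_bigr => h _.
  under eq_bigr do rewrite -mulrA.
  rewrite -mulr_sumr -/(U h); case: eqVneq => //= ->.
  suff -> : U 0 = 0 by rewrite mulr0.
  rewrite /U; have -> : \sum_x gchar R 0 x * (p x - q x)%:C%C =
      (\sum_(x : grid d n) (p x - q x))%:C%C.
    rewrite realc_sum; apply: eq_bigr => x _.
    by rewrite /gchar big1 ?mul1r// => j _; rewrite mxE zchar0.
  by rewrite sumrB pq subrr.
have c_le h : h \in s -> h != 0 -> normc (c h) <= Num.sqrt E.
  move=> hs h0; rewrite -(ger0_norm (normc_ge0 (c h))) -sqrtr_sqr ler_wsqrtr//.
  rewrite /E (bigD1_seq h)//= ler_wpDr//.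
    by apply: sumr_ge0 => k _; rewrite mulr_ge0 ?sqr_ge0.
  rewrite -[leLHS]mulr1 ler_wpM2l ?sqr_ge0//.
  by rewrite expr_ge1 ?enorm_Zvec_ge1 ?sqrtr_ge0.
apply: (@le_trans _ _ (\sum_(h <- s | h != 0) normc (c h) * normc (u h) +
    \sum_(h <- s | h != 0) normc (c h) * delta)).
  rewrite -big_split /=.
  have -> : \sum_x g x * (p x - q x) =
      complex.Re (\sum_(h <- s | h != 0) c h * U h) by rewrite -gU.
  apply: le_trans (Re_le_normc _) _.
  rewrite -[X in normc X]big_filter; apply: le_trans (normc_sum _ _) _.
  rewrite big_filter big_seq_cond [leRHS]big_seq_cond.
  apply: ler_sum => h /andP[hs _].
  rewrite ComplexField.Normc.normcM -mulrDr ler_wpM2l ?normc_ge0//.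
  rewrite -[U h](subrK (u h)) addrC (le_trans (le_normcD _ _))//.
  by rewrite lerD2l; exact: udelta.
rewrite mulrA mulrDr; apply: lerD; last first.
  apply: (@le_trans _ _ (\sum_(h <- s) Num.sqrt E * delta)).
    rewrite [leLHS]big_mkcond big_seq [leRHS]big_seq; apply: ler_sum => h hs.
    case: ifPn => [h0|_]; last by rewrite mulr_ge0 ?sqrtr_ge0.
    by rewrite ler_wpM2r// c_le.
  rewrite -mulr_suml big_const_seq count_predT iter_addr_0.
  rewrite -[_ *+ size s]mulr_natr -mulrA.
  by rewrite ler_wpM2r// mulr_ge0.
have -> : \sum_(h <- s | h != 0) normc (c h) * normc (u h) =
    \sum_(h <- s | h != 0) (normc (c h) * enorm (Zvec R h)) *
      (normc (u h) / enorm (Zvec R h)).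
  apply: eq_bigr => h h0; have := enorm_Zvec_ge1 R h0 => e1.
  by field; apply/eqP; lra.
rewrite -big_filter; apply: le_trans (cauchy_schwarz_sum _ _ _) _.
rewrite !big_filter; under [X in _ * Num.sqrt X <= _]eq_bigr do rewrite expr_div_n.
apply: ler_wpM2r; first exact: sqrtr_ge0.
apply: le_trans sqrtE; apply: ler_wsqrtr.
rewrite /E [leLHS]big_mkcond; apply: ler_sum => h _.
by case: ifP => _; rewrite ?exprMn// mulr_ge0 ?sqr_ge0.
Qed.

(** The first term pays, once for [p] and once for [q], for smoothing [f]; the
    second one is the pairing with the smoothed function. *)
Lemma lipschitz_pairing (R : realType) d n H (L delta : R) (f : grid d n -> R)
    (s : seq 'rV[int]_d) (p q : grid d n -> R) (u : 'rV[int]_d -> R[i]) :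
  (0 < H)%N -> (H.*2 < n.+2)%N -> uniq s ->
  (forall h : 'rV_d, (h \in s) = [forall j, `|h ord0 j| < H]%N) ->
  0 <= L -> (forall x y, f x - f y <= L * gdist R x y) ->
  (forall x, 0 <= p x) -> (forall x, 0 <= q x) ->
  \sum_x p x = 1 -> \sum_x q x = 1 -> 0 <= delta ->
  (forall h, h \in s ->
     normc (\sum_x gchar R h x * (p x - q x)%:C%C - u h) <= delta) ->
  \sum_x f x * (p x - q x) <=
  L * (2 * (d%:R / H.+1%:R) +
    Num.sqrt d%:R / (2 * pi * cos (pi * (H%:R / n.+2%:R))) *
    (Num.sqrt (\sum_(h <- s | h != 0) normc (u h) ^+ 2 / enorm (Zvec R h) ^+ 2)
     + (size s)%:R * delta)).
Proof.
move=> H0 Hn us sE L0 fL p0 q0 p1 q1 delta0 udelta.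
have Hn' : (0 < H < n.+2)%N by lia.
have sH h j : h \in s -> (`|h ord0 j| < H)%N by rewrite sE => /forallP.
have [h|c gE] := @smooth_span R d n H f s us.
  by move=> hH; rewrite sE; apply/forallP.
have gL j x := smooth_increment j x Hn' L0 fL.
have := trig_pairing Hn us sH gE L0 gL (etrans p1 (esym q1)) delta0 udelta.
rewrite [X in _ -> _ <= X]mulrDr; set B := L * (_ / _ * _) => gB.
have -> : \sum_x f x * (p x - q x) =
    \sum_x (f x - smooth H f x) * (p x - q x) +
    \sum_x smooth H f x * (p x - q x).
  by rewrite -big_split; apply: eq_bigr => x _ /=; rewrite -mulrDl subrK.
apply: lerD => //; set r := d%:R / _.
apply: (@le_trans _ _ (\sum_x L * r * (p x + q x))).
  apply: ler_sum => x _; apply: le_trans (ler_norm _) _.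
  rewrite normrM ler_pM//; first exact: smooth_approx.
  by rewrite (le_trans (ler_normB _ _))// !ger0_norm.
by rewrite -mulr_sumr big_split/= p1 q1; lra.
Qed.

(** * Fractional parts and cubes of the torus *)

Definition fpart (R : realType) (t : R) : R := t - (Num.floor t)%:~R.

(** The representative in [0, 1)^d. *)
Definition unit_rep (R : realType) d (x : torus R d) : 'rV[R]_d :=
  \row_j fpart (repr x ord0 j).

Lemma fpart_itv (R : realType) (t : R) : 0 <= fpart t < 1.
Proof.
rewrite /fpart; have := floor_itv t => /andP[h1 h2].
by rewrite intrD in h2; apply/andP; split; lra.
Qed.

Lemma fpartDz (R : realType) (t : R) (m : int) : fpart (t + m%:~R) = fpart t.
Proof. by rewrite /fpart floorDrz ?intr_int// intrKfloor intrD; ring. Qed.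

Lemma pi_torus_eq (R : realType) d (v w : 'rV[R]_d) :
  (forall j, v ord0 j - w ord0 j \is a Num.int) ->
  \pi_(torus R d)%qT v = \pi_(torus R d)%qT w.
Proof.
move=> vw; suff : v - w \in Zlattice_group R d.
  by rewrite Quotient.idealrBE => /eqP.
by apply/forallP => j; rewrite !mxE.
Qed.

Lemma repr_pi_torus (R : realType) d (v : 'rV[R]_d) j :
  repr (\pi_(torus R d)%qT v) ord0 j - v ord0 j \is a Num.int.
Proof.
have : repr (\pi_(torus R d)%qT v) - v \in Zlattice_group R d.
  by rewrite Quotient.idealrBE; apply/eqP; exact: reprK.
by move/forallP/(_ j); rewrite !mxE.
Qed.

Lemma unit_rep_pi (R : realType) d (v : 'rV[R]_d) j :
  unit_rep (\pi_(torus R d)%qT v) ord0 j = fpart (v ord0 j).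
Proof.
rewrite mxE; have /intrP[m rE] := repr_pi_torus v j.
by move/eqP: rE; rewrite subr_eq addrC => /eqP ->; rewrite fpartDz.
Qed.

Lemma pi_unit_rep (R : realType) d (x : torus R d) :
  \pi_(torus R d)%qT (unit_rep x) = x.
Proof.
rewrite -[RHS]reprK; apply: pi_torus_eq => j; rewrite mxE /fpart.
by rewrite addrAC subrr add0r rpredN intr_int.
Qed.

(** Fractional parts jump at the integers, so the condition [0 <] is what makes
    the set open. *)
Lemma open_unit_rep_lt (R : realType) d (j : 'I_d) (b : R) : b <= 1 ->
  open [set x : torus R d | 0 < unit_rep x ord0 j < b].
Proof.
move=> b1; rewrite /open/= /quotient_open.
have -> : \pi_(torus R d)%qT @^-1` [set x : torus R d | 0 < unit_rep x ord0 j < b] =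
    \bigcup_(m : int) (fun v : 'rV[R]_d => v ord0 j) @^-1`
      `]m%:~R, m%:~R + b[%classic.
  apply/seteqP; split => v /=.
    rewrite unit_rep_pi /fpart => /andP[h1 h2].
    exists (Num.floor (v ord0 j)) => //=.
    by rewrite in_itv/=; apply/andP; split; lra.
  move=> [m _] /=; rewrite in_itv/= unit_rep_pi => /andP[h1 h2].
  have -> : v ord0 j = (v ord0 j - m%:~R) + m%:~R by rewrite subrK.
  rewrite fpartDz; have fl : Num.floor (v ord0 j - m%:~R) = 0.
    by apply: floor_def; rewrite add0r; apply/andP; split; lra.
  by rewrite /fpart fl subr0; apply/andP; split; lra.
apply: bigcup_open => m _; apply: open_comp; last exact: interval_open.
by move=> v _; exact: coord_continuous.
Qed.

Lemma measurable_unit_rep_lt (R : realType) d (j : 'I_d) (b : R) :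
  measurable [set x : borel (torus R d) | unit_rep (x : torus R d) ord0 j < b].
Proof.
have mo (c : R) : c <= 1 ->
    measurable [set x : borel (torus R d) | 0 < unit_rep (x : torus R d) ord0 j < c].
  by move=> c1; apply: sub_sigma_algebra; exact: open_unit_rep_lt.
have itv (x : torus R d) : 0 <= unit_rep x ord0 j < 1 by rewrite mxE fpart_itv.
have [b0|b0] := leP b 0.
  rewrite [X in measurable X](_ : _ = set0)//; apply/seteqP; split=> // x /=.
  by have := itv x; lra.
rewrite [X in measurable X](_ : _ =
    ~` [set x : borel (torus R d) | 0 < unit_rep (x : torus R d) ord0 j < 1] `|`
    [set x : borel (torus R d) | 0 < unit_rep (x : torus R d) ord0 j < Num.min b 1]).
  apply: measurableU; last by apply: mo; rewrite ge_min lexx orbT.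
  by apply: measurableC; exact: mo.
apply/seteqP; split => x /=; have /andP[x0 x1] := itv x.
  move=> xb; have [x00|x00] := leP (unit_rep (x : torus R d) ord0 j) 0.
    by left.
  by right; rewrite lt_min xb x1.
case=> [/negP|/andP[_]]; last by rewrite lt_min => /andP[].
by rewrite negb_and -!leNgt => /orP[|]; lra.
Qed.

Lemma measurable_unit_rep (R : realType) d (j : 'I_d) :
  measurable_fun setT (fun x : borel (torus R d) => unit_rep (x : torus R d) ord0 j).
Proof.
move=> mT; apply: (measurability _ (RGenInftyO.measurableE R)) => //.
move=> _ [_ [r ->] <-]; rewrite setTI.
rewrite [X in measurable X](_ : _ =
    [set x : borel (torus R d) | unit_rep (x : torus R d) ord0 j < r]).
  exact: measurable_unit_rep_lt.
by apply/seteqP; split => x /=; rewrite in_itv.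
Qed.

(** The side of the cubes is 1/(n+2): a modulus of this form makes Z/(n+2)Z a
    ring without side conditions. *)
Definition cell (R : realType) d n (x : torus R d) : grid d n :=
  [ffun j => inord (Num.truncn (n.+2%:R * unit_rep x ord0 j)) : 'Z_n.+2].

Lemma cell_itv (R : realType) d n (x : torus R d) j :
  (cell n x j)%:R / n.+2%:R <= unit_rep x ord0 j < ((cell n x j)%:R + 1) / n.+2%:R.
Proof.
have N0 : 0 < n.+2%:R :> R by rewrite ltr0n.
have /andP[x0 x1] : 0 <= unit_rep x ord0 j < 1 by rewrite mxE fpart_itv.
have Nx0 : 0 <= n.+2%:R * unit_rep x ord0 j by rewrite mulr_ge0.
have /andP[t1 t2] := truncn_itv Nx0.
have tN : (Num.truncn (n.+2%:R * unit_rep x ord0 j) < n.+2)%N.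
  rewrite -(ltr_nat R); apply: le_lt_trans t1 _.
  by rewrite -[ltRHS]mulr1 ltr_pM2l.
rewrite ffunE inordK//.
by rewrite ler_pdivrMr// ltr_pdivlMr// ![_ * n.+2%:R]mulrC t1/= natr1.
Qed.

Lemma cellP (R : realType) d n (x : torus R d) (i : grid d n) :
  cell n x = i <-> forall j,
    (i j)%:R / n.+2%:R <= unit_rep x ord0 j < ((i j)%:R + 1) / n.+2%:R.
Proof.
have N0 : 0 < n.+2%:R :> R by rewrite ltr0n.
split=> [<- j|ix]; first exact: cell_itv.
apply/ffunP => j; apply/val_inj/eqP; have := cell_itv n x j; have := ix j.
rewrite !ler_pdivrMr// !ltr_pdivlMr//= !natr1 => /andP[a1 a2] /andP[b1 b2].
have := le_lt_trans a1 b2; have := le_lt_trans b1 a2.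
by rewrite !ltr_nat !ltnS eqn_leq => -> ->.
Qed.

Definition cube (R : realType) d n (i : grid d n) : set (borel (torus R d)) :=
  [set x | cell n (x : torus R d) = i].
Arguments cube R {d n} i _.

Lemma measurable_cube (R : realType) d n (i : grid d n) :
  measurable (cube R i).
Proof.
rewrite [X in measurable X](_ : _ = \bigcap_(j in [set: 'I_d])
   ((fun x : borel (torus R d) => unit_rep (x : torus R d) ord0 j) @^-1`
     `[(i j)%:R / n.+2%:R, ((i j)%:R + 1) / n.+2%:R[%classic)).
  apply: fin_bigcap_measurable => // j _.
  by rewrite -[X in measurable X]setTI; apply: measurable_unit_rep.
apply/seteqP; split => x.
  by move=> /cellP ix j _ /=; rewrite in_itv/= ix.
by move=> ix; apply/cellP => j; have := ix j Logic.I; rewrite /= in_itv.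
Qed.

(** The integer [k] realizing the distance of the two grid points on the cycle
    also serves for points of their cells, which are shifted by amounts in
    [0, 1/(n+2)). *)
Lemma cycle_dist (R : realType) n (s t : 'Z_n.+2) (a b : R) :
  s%:R / n.+2%:R <= a < (s%:R + 1) / n.+2%:R ->
  t%:R / n.+2%:R <= b < (t%:R + 1) / n.+2%:R ->
  exists k : int, `|a - b - k%:~R| <= ((znorm (s - t))%:R + 1) / n.+2%:R.
Proof.
move=> sa tb; have N0 : 0 < n.+2%:R :> R by rewrite ltr0n.
have [k kE] : exists k : int,
    `|s%:R - t%:R - k%:~R * n.+2%:R| = (znorm (s - t))%:R :> R.
  have rN : ((s - t)%R < n.+2)%N by exact: ltn_ord.
  have := val_ZpD (s - t) t; rewrite subrK /znorm; set r := nat_of_ord (s - t).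
  move=> sE; have [e eE] : exists e : nat,
      (s : nat)%:R - t%:R = r%:R - e%:R * n.+2%:R :> R.
    move: sE; case: ifP => rt sE.
      by exists 0%N; rewrite sE natrD; ring.
    exists 1%N; rewrite sE natrB; last by rewrite leqNgt rt.
    by rewrite natrD; ring.
  case: (leqP r (n.+2 - r)) => rr.
    exists (- e%:Z); rewrite eE rmorphN/= -pmulrn.
    by rewrite (_ : _ - _ = r%:R) ?ger0_norm//; ring.
  exists (1 - e%:Z); rewrite eE rmorphB/= -pmulrn.
  rewrite (_ : _ - _ = - (n.+2 - r)%:R); last by rewrite natrB 1?ltnW//; ring.
  by rewrite normrN ger0_norm.
exists k; rewrite ler_pdivlMr//.
rewrite -[X in _ * X](gtr0_norm N0) -normrM -kE.
have -> : (a - b - k%:~R) * n.+2%:R = (s%:R - t%:R - k%:~R * n.+2%:R) +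
   ((a * n.+2%:R - s%:R) - (b * n.+2%:R - t%:R)) by ring.
apply: le_trans (ler_normD _ _) _; rewrite lerD2l.
move: sa tb; rewrite !ler_pdivrMr// !ltr_pdivlMr// => /andP[? ?] /andP[? ?].
by rewrite ler_norml; apply/andP; split; lra.
Qed.

Lemma enorm_le_l1 (R : realType) d (v : 'rV[R]_d) :
  enorm v <= \sum_(j < d) `|v ord0 j|.
Proof.
have S0 : 0 <= \sum_(j < d) `|v ord0 j| by apply: sumr_ge0.
rewrite -ler_sqr ?nnegrE ?sqrtr_ge0// enorm_sqr [leRHS]expr2 mulr_suml.
apply: ler_sum => j _; rewrite -real_normK ?num_real// expr2 ler_wpM2l//.
by rewrite (bigD1 j)//= lerDl; apply: sumr_ge0.
Qed.

Lemma tdist_ge0 (R : realType) d (x y : torus R d) : 0 <= tdist x y.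
Proof.
apply: lb_le_inf; first by exists (enorm (repr x - repr y - Zvec R 0)), 0.
by move=> _ [m _ <-]; exact: sqrtr_ge0.
Qed.

Lemma tdist_le_gdist (R : realType) d n (x y : torus R d) :
  tdist x y <= gdist R (cell n x) (cell n y) + d%:R / n.+2%:R.
Proof.
have kP j : exists k : int, `|unit_rep x ord0 j - unit_rep y ord0 j - k%:~R| <=
    ((znorm (cell n x j - cell n y j))%:R + 1) / n.+2%:R.
  by apply: cycle_dist; exact: cell_itv.
have [k {}kP] := choice kP.
pose m : 'rV[int]_d := \row_j
  (k j + Num.floor (repr x ord0 j) - Num.floor (repr y ord0 j)).
apply: (@le_trans _ _ (enorm (repr x - repr y - Zvec R m))).
  apply: ge_inf; last by exists m.
  by exists 0 => _ [? _ <-]; exact: sqrtr_ge0.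
apply: le_trans (enorm_le_l1 _) _.
have -> : gdist R (cell n x) (cell n y) + d%:R / n.+2%:R =
    \sum_(j < d) ((znorm (cell n x j - cell n y j))%:R + 1) / n.+2%:R.
  under [RHS]eq_bigr do rewrite mulrDl mul1r.
  by rewrite big_split/= sumr_const card_ord mulr_natl.
apply: ler_sum => j _; apply: le_trans (kP j).
rewrite le_eqVlt; apply/orP; left; apply/eqP; congr `|_|.
by rewrite !mxE /fpart !intrD mulrNz; ring.
Qed.

(** A point is the image of its fractional part, and points of one cube have
    fractional parts within 1/(n+2) of each other. *)
Lemma cell_basis (R : realType) d (x : torus R d) (O : set (torus R d)) :
  nbhs x O -> \forall n \near \oo,
    forall y : torus R d, cell n y = cell n x -> O y.
Proof.
rewrite nbhsE => -[U [oU Ux] UO].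
have : nbhs (unit_rep x) (\pi_(torus R d)%qT @^-1` U).
  by apply: open_nbhs_nbhs; split; [exact: oU|rewrite /preimage/= pi_unit_rep].
move=> /nbhs_ballP[e e0 eU].
near=> n => y yx; apply: UO; rewrite -(pi_unit_rep y); apply: eU; split => // i j.
have {i}-> : i = ord0 by apply/val_inj; case: i => -[].
rewrite /ball/=.
have /andP[x0 x1] := cell_itv n x j.
have /andP[y0 y1] := cell_itv n y j.
have Ne : n.+2%:R^-1 < e.
  apply: (@le_lt_trans _ _ n.+1%:R^-1).
    by rewrite lef_pV2 ?posrE ?ltr0n// ler_nat.
  by near: n; exact: near_infty_natSinv_lt (PosNum e0).
apply: le_lt_trans Ne; rewrite yx in y0 y1.
rewrite mulrDl mul1r in x1 y1.
have dist (a b c r : R) :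
    c <= a -> a < c + r -> c <= b -> b < c + r -> `|a - b| <= r.
  by move=> *; rewrite ler_norml; apply/andP; split; lra.
exact: dist x0 x1 y0 y1.
Unshelve. all: by end_near. Qed.

(** Open sets of the square of the torus are countable unions of products of
    cubes, so that the Borel sets of the product topology belong to the product
    of the Borel sigma-algebras. *)
Lemma measurable_borel_square (R : realType) d :
  measurable_fun [set: borel (torus R d) * borel (torus R d)]
    (fun p => p : borel (torus R d * torus R d)%type).
Proof.
apply: measurability => //.
move=> _ [U oU <-]; rewrite setTI.
rewrite [X in measurable X](_ : _ = \bigcup_n \bigcup_(ij in
    [set ij : grid d n * grid d n |
       cube R ij.1 `*` cube R ij.2 `<=` U]) (cube R ij.1 `*` cube R ij.2)).
  apply: bigcupT_measurable => n; apply: fin_bigcup_measurable => // ij _.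
  by apply: measurableX; exact: measurable_cube.
apply/seteqP; split => [[x y] Uxy|[x y] [n _ [ij sub ijxy]]]; last exact: sub.
have [[A B] /= [nA nB] AB] : nbhs ((x, y) : torus R d * torus R d) U.
  by apply: open_nbhs_nbhs; split.
have [n [An Bn]] := filter_ex (filterI (cell_basis nA) (cell_basis nB)).
exists n => //; exists (cell n (x : torus R d), cell n (y : torus R d)) => //.
by move=> [x' y'] /= [x'x y'y]; apply: AB; split; [exact: An|exact: Bn].
Qed.

(** * Gluing couplings of the cubes *)

(** The integral of a nonnegative function is a supremum over the simple
    functions below it, hence monotone on all nonnegative functions; it is used
    with [f] the distance between the two coordinates of the torus square. *)
Lemma le_integral_ge0 (disp : measure_display) (X : measurableType disp)
    (R : realType) (mu : {measure set X -> \bar R}) (f g : X -> \bar R) :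
  (forall x, 0 <= f x)%E -> (forall x, f x <= g x)%E ->
  (\int[mu]_x f x <= \int[mu]_x g x)%E.
Proof.
move=> f0 fg; have g0 x : (0 <= g x)%E := le_trans (f0 x) (fg x).
rewrite !ge0_integralTE//; apply: ereal_sup_le => _ [h hf <-].
by exists h => // x; exact: le_trans (hf x) (fg x).
Qed.

Lemma integral_fin_fun (disp : measure_display) (X : measurableType disp)
    (R : realType) (P : probability X R) (I : finType) (kappa : X -> I)
    (v : I -> R) :
  (forall i, measurable (kappa @^-1` [set i])) ->
  P.-integrable setT (EFin \o (v \o kappa)) /\
  \int[P]_x (v (kappa x)) = \sum_i v i * fine (P (kappa @^-1` [set i])).
Proof.
move=> mk; pose h i (x : X) : \bar R :=
  ((v i)%:E * (\1_(kappa @^-1` [set i]) x)%:E)%E.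
have hi i : P.-integrable setT (h i).
  apply: integrableZl => //.
  by apply: integrable_indic.
have vE x : (v (kappa x))%:E = (\sum_i h i x)%E.
  rewrite (bigD1 (kappa x))//= big1 => [|i ik]; rewrite /h indicE.
    by rewrite mem_set// mule1 adde0.
  by rewrite memNset ?mule0// => ki; rewrite -ki eqxx in ik.
split.
  rewrite (_ : EFin \o _ = fun x => (\sum_i h i x)%E); first exact: integrable_sum.
  by apply/funext => x; rewrite /= vE.
rewrite /Rintegral; under eq_integral do rewrite vE.
rewrite integral_sum//; have hE i : (\int[P]_x h i x)%E =
    (v i * fine (P (kappa @^-1` [set i])))%:E.
  rewrite integralZl ?integral_indic//; last exact: integrable_indic.
  by rewrite setIT EFinM fineK// fin_num_measure.
by under eq_bigr do rewrite hE; rewrite sumEFin.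
Qed.

Lemma measure_fibers (disp : measure_display) (X : measurableType disp)
    (R : realType) (mu : {measure set X -> \bar R}) (I : finType)
    (kappa : X -> I) (A : set X) :
  (forall i, measurable (kappa @^-1` [set i])) -> measurable A ->
  mu A = (\sum_i mu (A `&` kappa @^-1` [set i]))%E.
Proof.
move=> mk mA; have {1}-> : A =
    \bigcup_(i in [set` index_enum I]) (A `&` kappa @^-1` [set i]).
  apply/seteqP; split => [x Ax|x [i _ []//]].
  by exists (kappa x) => //=; exact: mem_index_enum.
rewrite measure_fin_bigcup//.
- by rewrite -fsbig_seq// index_enum_uniq.
- apply/trivIsetP => i j _ _ /negP ij; apply/seteqP; split=> // x.
  by move=> [[_ xi] [_ xj]]; apply: ij; apply/eqP; exact: etrans (esym xi) xj.
- by move=> i _; exact: measurableI.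
Qed.

Lemma mixture_exists (disp : measure_display) (X : measurableType disp)
    (R : realType) (P : {measure set X -> \bar R}) (I : finType)
    (D : I -> set X) (a : I -> R) :
  (forall i, measurable (D i)) -> (forall i, 0 <= a i) ->
  (\sum_i (a i)%:E * P (D i) = 1)%E ->
  exists theta : probability X R, forall A,
    theta A = (\sum_i (a i)%:E * P (A `&` D i))%E.
Proof.
move=> mD a0 aP1.
pose F (k : nat) : {measure set X -> \bar R} :=
  if insub k is Some o then
    mscale (NngNum (a0 (enum_val (o : 'I_#|I|)))) (mrestr P (mD (enum_val o)))
  else mzero.
have FE A : msum F #|I| A = (\sum_i (a i)%:E * P (A `&` D i))%E.
  rewrite /msum [RHS](reindex (@enum_val I predT)) /=; last first.
    by exists enum_rank => i _; rewrite ?enum_valK ?enum_rankK.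
  by apply: eq_bigr => i _; rewrite /F valK.
have mu1 : msum F #|I| setT = 1%E.
  by rewrite FE -aP1; apply: eq_bigr => i _; rewrite setTI.
pose pr := Measure_isProbability.Build _ _ _ (msum F #|I|) mu1.
by exists (HB.pack_for (probability X R) (msum F #|I|) pr).
Qed.

Definition borel_square_id (R : realType) d
  (p : borel (torus R d) * borel (torus R d)) :
  borel (torus R d * torus R d)%type := p.

HB.instance Definition _ (R : realType) d := isMeasurableFun.Build _ _ _ _
  (@borel_square_id R d) (@measurable_borel_square R d).

(** Transporting the conditional law of [nu1] on each cube to conditional laws
    of [nu2] by product measures extends a coupling of the masses of the cubes
    to a coupling of [nu1] and [nu2]. *)
Lemma gluing (R : realType) d n (nu1 nu2 : probability (borel (torus R d)) R)
    (w : grid d n -> grid d n -> R) :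
  (forall i j, 0 <= w i j) ->
  (forall i, \sum_j w i j = fine (nu1 (cube R i))) ->
  (forall j, \sum_i w i j = fine (nu2 (cube R j))) ->
  exists2 theta : probability (borel (torus R d * torus R d)%type) R,
    coupling nu1 nu2 theta &
    forall i j, theta [set p | cell n p.1 = i /\ cell n p.2 = j] = (w i j)%:E.
Proof.
move=> w0 w1 w2.
pose p1 (i : grid d n) := fine (nu1 (cube R i)).
pose p2 (j : grid d n) := fine (nu2 (cube R j)).
(* Where a cube has mass 0 the quotient is 0, consistently with [w]. *)
pose a (ij : grid d n * grid d n) := w ij.1 ij.2 / (p1 ij.1 * p2 ij.2).
have p10 i : 0 <= p1 i by apply: fine_ge0.
have p20 j : 0 <= p2 j by apply: fine_ge0.
have a0 ij : 0 <= a ij by rewrite divr_ge0// mulr_ge0.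
have w_p1 i j : p1 i = 0 -> w i j = 0.
  rewrite /p1 -w1 => /eqP; rewrite psumr_eq0// => /allP/(_ j).
  by rewrite mem_index_enum => /(_ isT)/eqP.
have w_p2 i j : p2 j = 0 -> w i j = 0.
  rewrite /p2 -w2 => /eqP; rewrite psumr_eq0// => /allP/(_ i).
  by rewrite mem_index_enum => /(_ isT)/eqP.
have aE i j : a (i, j) * (p1 i * p2 j) = w i j.
  rewrite /a /=; have [z|n1] := eqVneq (p1 i) 0; first by rewrite w_p1// !mul0r.
  have [z|n2] := eqVneq (p2 j) 0; first by rewrite w_p2// !mul0r.
  by rewrite divfK// mulf_neq0.
pose D (ij : grid d n * grid d n) :
    set (borel (torus R d) * borel (torus R d)) :=
  cube R ij.1 `*` cube R ij.2.
have mD ij : measurable (D ij) by apply: measurableX; exact: measurable_cube.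
have finE nu (A : set (borel (torus R d))) :
    measurable A -> (fine ((nu : probability _ R) A))%:E = nu A.
  by move=> mA; rewrite fineK// fin_num_measure.
have PX (A B : set (borel (torus R d))) : measurable A -> measurable B ->
    ((nu1 \x nu2) (A `*` B) = (fine (nu1 A) * fine (nu2 B))%:E)%E.
  by move=> mA mB; rewrite product_measure1E// EFinM !finE.
have mC (i : grid d n) : measurable (cube R i) := @measurable_cube R d n i.
have PC i j : ((nu1 \x nu2) (cube R i `*` cube R j) = (p1 i * p2 j)%:E)%E.
  exact: PX.
have sum1 : (\sum_ij (a ij)%:E * (nu1 \x nu2) (D ij) = 1)%E.
  rewrite -(pair_bigA _ (fun i j => (a (i, j))%:E * (nu1 \x nu2) (D (i, j))))%E.
  under eq_bigr => i _.
    under eq_bigr do rewrite PC -EFinM aE.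
    rewrite sumEFin w1 finE//.
    rewrite -[cube R i]setTI; over.
  transitivity (nu1 setT); last exact: probability_setT.
  by rewrite [RHS](measure_fibers nu1 mC).
have [th0 th0E] := mixture_exists mD a0 sum1.
have mass0 nu (A : set (borel (torus R d))) (i : grid d n) : measurable A ->
    fine ((nu : probability _ R) (cube R i)) = 0 -> fine (nu (A `&` cube R i)) = 0.
  move=> mA nu0; apply/eqP; rewrite eq_le fine_ge0// andbT -nu0 -lee_fin !finE//.
    by apply: le_measure; rewrite ?inE//; exact: measurableI.
  exact: measurableI.
exists (distribution th0 (@borel_square_id R d)) => [A mA|i j].
  have mAC (i : grid d n) : measurable (A `&` cube R i) by exact: measurableI.
  split; rewrite /distribution /pushforward th0E.
    rewrite [RHS](measure_fibers nu1 mC)// -(pair_bigA _ (fun i j =>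
      (a (i, j))%:E * (nu1 \x nu2)
        ((@borel_square_id R d @^-1` [set p | A p.1]) `&` D (i, j))))%E.
    apply: eq_bigr => i _.
    have DE j : (@borel_square_id R d @^-1` [set p | A p.1]) `&` D (i, j) =
        (A `&` cube R i) `*` cube R j.
      by apply/seteqP; split => [[x y] [Ax [xi yj]]|[x y] [[Ax xi] yj]].
    under eq_bigr => j _ do rewrite DE (PX _ _ (mAC i) (mC j)) -EFinM.
    rewrite sumEFin -[RHS]finE; last exact: mAC.
    congr EFin; have [p1i|p1i] := eqVneq (p1 i) 0.
      rewrite [RHS]mass0// big1// => j _.
      by rewrite mass0// mul0r mulr0.
    apply: (mulfI p1i); rewrite mulr_sumr {2}/p1 -w1 mulr_suml.
    by apply: eq_bigr => j _; rewrite -aE /p2; ring.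
  rewrite [RHS](measure_fibers nu2 mC)// -(pair_bigA _ (fun i j =>
    (a (i, j))%:E * (nu1 \x nu2)
      ((@borel_square_id R d @^-1` [set p | A p.2]) `&` D (i, j))))%E.
  rewrite exchange_big; apply: eq_bigr => j _.
  have DE i : (@borel_square_id R d @^-1` [set p | A p.2]) `&` D (i, j) =
      cube R i `*` (A `&` cube R j).
    by apply/seteqP; split => [[x y] [Ay [xi yj]]|[x y] [xi [Ay yj]]].
  under eq_bigr => i _ do rewrite DE (PX _ _ (mC i) (mAC j)) -EFinM.
  rewrite sumEFin -[RHS]finE; last exact: mAC.
  congr EFin; have [p2j|p2j] := eqVneq (p2 j) 0.
    rewrite [RHS]mass0// big1// => i _.
    by rewrite [X in _ * (_ * X)]mass0// !mulr0.
  apply: (mulfI p2j); rewrite mulr_sumr {2}/p2 -w2 mulr_suml.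
  by apply: eq_bigr => i _; rewrite -aE /p1; ring.
rewrite /distribution /pushforward th0E (bigD1 (i, j))//= big1.
  rewrite adde0.
  have -> : (@borel_square_id R d @^-1`
      [set p | cell n p.1 = i /\ cell n p.2 = j]) `&` D (i, j) = D (i, j).
    by apply/seteqP; split => [[x y] []|[x y]].
  by rewrite PC -EFinM aE.
move=> [k l] /= kl.
rewrite [X in (nu1 \x nu2)%E X](_ : _ = set0) ?measure0 ?mule0//.
apply/seteqP; split => // -[x y] [/= [xi yj] [xk yl]].
have ki : k = i by exact: etrans (esym xk) xi.
have lj : l = j by exact: etrans (esym yl) yj.
by rewrite ki lj eqxx in kl.
Qed.

(** * Fourier coefficients from the masses of the cubes *)

Lemma Rintegral_dist_le (disp : measure_display) (X : measurableType disp)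
    (R : realType) (P : probability X R) (f g : X -> R) (e : R) :
  P.-integrable setT (EFin \o f) -> P.-integrable setT (EFin \o g) ->
  (forall x, `|f x - g x| <= e) ->
  `|\int[P]_x f x - \int[P]_x g x| <= e.
Proof.
move=> fi gi fg.
have P1 : fine (P setT) = 1 by rewrite [P setT]probability_setT.
have ie : P.-integrable setT (EFin \o cst e) by exact: finite_measure_integrable_cst.
have half (u v : X -> R) : P.-integrable setT (EFin \o u) ->
    P.-integrable setT (EFin \o v) -> (forall x, `|u x - v x| <= e) ->
    \int[P]_x u x <= \int[P]_x v x + e.
  move=> ui vi uv; rewrite -[X in _ + X]mulr1 -P1 -Rintegral_cst// -RintegralD//.
  apply: le_Rintegral => //; first exact: (integrableD measurableT vi ie).
  by move=> x _; have := uv x; rewrite ler_norml => /andP[]; lra.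
have h1 := half f g fi gi fg; have h2 : \int[P]_x g x <= \int[P]_x f x + e.
  by apply: half => // x; rewrite distrC.
by rewrite ler_norml; apply/andP; split; lra.
Qed.

Lemma measurable_inner (R : realType) d (h : 'rV[int]_d) :
  measurable_fun setT (fun x : borel (torus R d) => inner h (unit_rep (x : torus R d))).
Proof.
rewrite /inner; apply: measurable_sum => j.
by apply: measurable_funM => //; exact: measurable_unit_rep.
Qed.

Lemma cis_inner_repr (R : realType) d (h : 'rV[int]_d) (x : torus R d) :
  cis (- (2 * pi * inner h (repr x))) = cis (- (2 * pi * inner h (unit_rep x))).
Proof.
have -> : inner h (repr x) = inner h (unit_rep x) +
    (\sum_(j < d) h ord0 j * Num.floor (repr x ord0 j))%:~R.
  rewrite /inner rmorph_sum -big_split; apply: eq_bigr => j _ /=.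
  by rewrite !mxE /fpart rmorphM/= ; ring.
by rewrite mulrDr opprD cisD -mulrN -mulrN -rmorphN cis_period mulr1 mulrN.
Qed.

Lemma gcharE (R : realType) d n (h : 'rV[int]_d) (x : grid d n) :
  gchar R h x =
  cis (- (2 * pi * inner h (\row_j ((x j)%:R / n.+2%:R)))).
Proof.
rewrite /gchar /zchar -cis_sum; congr cis.
rewrite sumrN /inner mulr_sumr; congr (- _); apply: eq_bigr => j _.
by rewrite mxE.
Qed.

Lemma normc_cis_cell (R : realType) d n H (h : 'rV[int]_d) (x : torus R d) :
  (forall j, `|h ord0 j| <= H)%N ->
  normc (cis (- (2 * pi * inner h (repr x))) - gchar R h (cell n x)) <=
  2 * pi * (d%:R * H%:R / n.+2%:R).
Proof.
move=> hH; have p0 := @pi_gt0 R.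
have N0 : 0 < n.+2%:R :> R by rewrite ltr0n.
rewrite cis_inner_repr gcharE; apply: le_trans (normc_cis_sub_le _ _) _.
rewrite -opprD -mulrBr normrN normrM (ger0_norm (_ : 0 <= 2 * pi)); last first.
  by rewrite mulr_ge0// ltW.
rewrite ler_pM2l ?mulr_gt0// /inner -sumrB.
apply: le_trans (ler_norm_sum _ _ _) _.
have -> : d%:R * H%:R / n.+2%:R = \sum_(j < d) H%:R / n.+2%:R :> R.
  by rewrite sumr_const card_ord -mulrA mulr_natl.
apply: ler_sum => j _; rewrite -mulrBr normrM ler_pM//.
  by rewrite -intr_norm -abszE -pmulrn ler_nat.
rewrite [X in _ - X]mxE.
have := cell_itv n x j; rewrite mulrDl mul1r => /andP[x0 /ltW x1].
by rewrite ger0_norm ?subr_ge0// lerBlDl.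
Qed.

(** The phase varies by at most 2 pi d H / (n+2) on a cube; the real and the
    imaginary parts each contribute this error. *)
Lemma fourier_discretization (R : realType) d n H (h : 'rV[int]_d)
    (nu : probability (borel (torus R d)) R) :
  (forall j, `|h ord0 j| <= H)%N ->
  normc (\sum_x gchar R h x * (fine (nu (@cube R d n x)))%:C%C
         - fourier_coef nu h) <=
  4 * pi * (d%:R * H%:R / n.+2%:R).
Proof.
move=> hH; set e := _ / _.
pose f (x : borel (torus R d)) : R[i] :=
  cis (- (2 * pi * inner h (repr (x : torus R d)))).
have fg (x : borel (torus R d)) :
    normc (f x - gchar R h (cell n (x : torus R d))) <= 2 * pi * e.
  exact: normc_cis_cell.
have mphase : measurable_fun setT
    (fun x : borel (torus R d) => - (2 * pi * inner h (unit_rep (x : torus R d)))).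
  by apply: measurableT_comp => //; apply: measurable_funM => //;
     exact: measurable_inner.
have bint (u : R -> R) : continuous u -> (forall t, `|u t| <= 1) ->
    nu.-integrable setT (EFin \o
      (fun x : borel (torus R d) => u (- (2 * pi * inner h (unit_rep (x : torus R d)))))).
  move=> uc u1; apply: measurable_bounded_integrable => //.
  - exact: fin_num_fun_lty (fin_num_measure nu).
  - by apply: measurableT_comp mphase; exact: continuous_measurable_fun.
  - by exists 1; split=> // M M1 x _ /=; apply: le_trans (u1 _) (ltW M1).
have fRe : nu.-integrable setT (EFin \o (fun x => complex.Re (f x))).
  rewrite (_ : (fun x => _) = (fun x : borel (torus R d) =>
      cos (- (2 * pi * inner h (unit_rep (x : torus R d)))))).
    by apply: bint; [exact: continuous_cos|exact: cos_max].
  by apply/funext => x; rewrite /f cis_inner_repr.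
have fIm : nu.-integrable setT (EFin \o (fun x => complex.Im (f x))).
  rewrite (_ : (fun x => _) = (fun x : borel (torus R d) =>
      sin (- (2 * pi * inner h (unit_rep (x : torus R d)))))).
    by apply: bint; [exact: continuous_sin|exact: sin_max].
  by apply/funext => x; rewrite /f cis_inner_repr.
have mc (i : grid d n) : measurable
    ((fun x : borel (torus R d) => cell n (x : torus R d)) @^-1` [set i]).
  exact: measurable_cube.
have [gRe gReE] := integral_fin_fun nu (fun i => complex.Re (gchar R h i)) mc.
have [gIm gImE] := integral_fin_fun nu (fun i => complex.Im (gchar R h i)) mc.
have ReB (a b : R[i]) : complex.Re (a - b) = complex.Re a - complex.Re b.
  by case: a b => ? ? [].
have ImB (a b : R[i]) : complex.Im (a - b) = complex.Im a - complex.Im b.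
  by case: a b => ? ? [].
have absRe (a b : R[i]) : `|complex.Re a - complex.Re b| <= normc (a - b).
  rewrite -ReB -ler_sqr ?nnegrE ?normc_ge0// real_normK ?num_real//.
  by rewrite normc_sqr lerDl sqr_ge0.
have absIm (a b : R[i]) : `|complex.Im a - complex.Im b| <= normc (a - b).
  rewrite -ImB -ler_sqr ?nnegrE ?normc_ge0// real_normK ?num_real//.
  by rewrite normc_sqr lerDr sqr_ge0.
have dRe := Rintegral_dist_le fRe gRe (fun x => le_trans (absRe _ _) (fg x)).
have dIm := Rintegral_dist_le fIm gIm (fun x => le_trans (absIm _ _) (fg x)).
set z := _ - _.
have zRe : complex.Re z = \sum_x complex.Re (gchar R h x) *
    fine (nu (@cube R d n x)) - \int[nu]_x complex.Re (f x).
  rewrite /z ReB; congr (_ - _).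
  rewrite (raddf_sum (@complex.Re R : Rcomplex R -> R)).
  by apply: eq_bigr => x _; case: (gchar R h x) => a b /=; ring.
have zIm : complex.Im z = \sum_x complex.Im (gchar R h x) *
    fine (nu (@cube R d n x)) - \int[nu]_x complex.Im (f x).
  rewrite /z ImB; congr (_ - _).
  rewrite (raddf_sum (@complex.Im R : Rcomplex R -> R)).
  by apply: eq_bigr => x _; case: (gchar R h x) => a b /=; ring.
apply: le_trans (normc_le_ReIm _) _.
have -> : 4 * pi * e = 2 * pi * e + 2 * pi * e by ring.
apply: lerD; first by rewrite zRe distrC -gReE.
by rewrite zIm distrC -gImE.
Qed.

(** * Passing from the grid to the torus *)

(** The shifted index set {0, ..., 2H} also contains the frequencies -H and H,
    which the filter removes. *)
Definition freqs d (H : nat) : seq 'rV[int]_d :=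
  undup [seq h : 'rV[int]_d <-
    [seq \row_j ((p j : nat)%:Z - H%:Z) | p : {ffun 'I_d -> 'I_H.*2.+1}] |
    [forall j, `|h ord0 j| < H]%N].

Lemma row_ord0_inj (T : Type) d (u v : 'rV[T]_d) :
  (forall j, u ord0 j = v ord0 j) -> u = v.
Proof. by move=> uv; apply/matrixP => i j; rewrite (ord1 i) -[0]/ord0. Qed.

Lemma mem_freqs d H (h : 'rV[int]_d) :
  (h \in freqs d H) = [forall j, `|h ord0 j| < H]%N.
Proof.
rewrite mem_undup mem_filter andb_idr// => /forallP hH; apply/mapP.
exists [ffun j => inord (absz (h ord0 j + H%:Z))]; first by rewrite mem_enum.
apply: row_ord0_inj => j; rewrite !mxE ffunE.
by have := hH j => /= hj; rewrite inordK; lia.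
Qed.

Lemma Zsupnorm_lt d H (h : 'rV[int]_d) : (0 < H)%N ->
  (Zsupnorm h < H)%N = [forall j, `|h ord0 j| < H]%N.
Proof.
case: H => // H _; rewrite ltnS; apply/bigmax_leqP/forallP => hH j.
  by rewrite ltnS hH.
by move=> _; have := hH j; rewrite ltnS.
Qed.

Lemma Zsupnorm_gt0 d (h : 'rV[int]_d) : (0 < Zsupnorm h)%N = (h != 0).
Proof.
rewrite lt0n -leqn0; congr (~~ _); apply/bigmax_leqP/eqP => [h0|-> j _].
  apply: row_ord0_inj => j; rewrite mxE; apply/eqP.
  by rewrite -absz_eq0 -leqn0; exact: h0.
by rewrite mxE.
Qed.

Lemma fsbig_freqs (R : realType) d H (F : 'rV[int]_d -> R) : (0 < H)%N ->
  \sum_(h \in [set h : 'rV[int]_d | (0 < Zsupnorm h < H)%N]) F h =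
  \sum_(h <- freqs d H | h != 0) F h.
Proof.
move=> H0; rewrite -[RHS]big_filter [RHS]fsbig_seq ?filter_uniq ?undup_uniq//.
congr (\sum_(h \in _) _); apply/seteqP; split => h /=;
  by rewrite mem_filter mem_freqs Zsupnorm_gt0 Zsupnorm_lt.
Qed.

Lemma measurable_borel_fst (R : realType) d :
  measurable_fun setT (fun p : borel (torus R d * torus R d)%type =>
    (p : torus R d * torus R d).1 : borel (torus R d)).
Proof.
apply: measurability => // _ [U oU <-]; rewrite setTI.
apply: sub_sigma_algebra; apply: open_comp oU => p _; exact: cvg_fst.
Qed.

Lemma measurable_borel_snd (R : realType) d :
  measurable_fun setT (fun p : borel (torus R d * torus R d)%type =>
    (p : torus R d * torus R d).2 : borel (torus R d)).
Proof.
apply: measurability => // _ [U oU <-]; rewrite setTI.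
apply: sub_sigma_algebra; apply: open_comp oU => p _; exact: cvg_snd.
Qed.

Lemma sum_cube_mass (R : realType) d n (nu : probability (borel (torus R d)) R) :
  \sum_(i : grid d n) fine (nu (cube R i)) = 1.
Proof.
apply: EFin_inj; rewrite -sumEFin -(@probability_setT _ _ _ nu).
rewrite [RHS](measure_fibers nu (@measurable_cube R d n))//.
apply: eq_bigr => i _; rewrite setTI fineK// fin_num_measure//.
exact: measurable_cube.
Qed.

(** Duality yields a coupling of the masses of the cubes; after gluing, the cost
    is dominated by a function of the pair of cubes, whose integral only involves
    those masses. *)
Lemma W1_le_grid (R : realType) d n (nu1 nu2 : probability (borel (torus R d)) R)
    (B : R) :
  (forall (L : R) (f : grid d n -> R), 0 <= L ->
     (forall x y, f x - f y <= L * gdist R x y) ->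
     \sum_x f x * (fine (nu1 (cube R x)) - fine (nu2 (cube R x))) <= L * B) ->
  (W1 nu1 nu2 <= (B + d%:R / n.+2%:R)%:E)%E.
Proof.
move=> dual.
have [w [w0 w1 w2 wB]] := kantorovich_finite (0 : grid d n) (@gdistxx R d n)
  (@gdist_triangle R d n) (fun x => fine_ge0 (measure_ge0 nu1 (cube R x)))
  (fun x => fine_ge0 (measure_ge0 nu2 (cube R x))) dual.
have [theta theta12 thetaw] := gluing w0 w1 w2.
apply: (@le_trans _ _ (\int[theta]_p (tdist p.1 p.2)%:E)%E).
  by apply: ereal_inf_lbound; exists theta.
pose kappa (p : borel (torus R d * torus R d)%type) : grid d n * grid d n :=
  (cell n (p : torus R d * torus R d).1, cell n (p : torus R d * torus R d).2).
pose v (ij : grid d n * grid d n) := gdist R ij.1 ij.2 + d%:R / n.+2%:R.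
have kE i j : kappa @^-1` [set (i, j)] =
    [set p | cell n (p : torus R d * torus R d).1 = i /\
             cell n (p : torus R d * torus R d).2 = j].
  by apply/seteqP; split => p /= => [[]|[]] xi yj; rewrite /kappa ?xi ?yj.
have mk ij : measurable (kappa @^-1` [set ij]).
  case: ij => i j; rewrite kE; apply: measurableI.
    rewrite -[X in measurable X]setTI.
    exact: (measurable_borel_fst measurableT (measurable_cube i)).
  rewrite -[X in measurable X]setTI.
  exact: (measurable_borel_snd measurableT (measurable_cube j)).
have [vi vE] := integral_fin_fun theta v mk.
apply: (@le_trans _ _ (\int[theta]_p (v (kappa p))%:E)%E).
  apply: le_integral_ge0 => p; first by rewrite lee_fin tdist_ge0.
  by rewrite lee_fin tdist_le_gdist.
rewrite -[leLHS]fineK; last exact: integrable_fin_num.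
rewrite [fine _]vE lee_fin.
have -> : \sum_ij v ij * fine (theta (kappa @^-1` [set ij])) =
    \sum_i \sum_j w i j * gdist R i j + d%:R / n.+2%:R.
  transitivity (\sum_i \sum_j v (i, j) * fine (theta (kappa @^-1` [set (i, j)]))).
    by rewrite pair_bigA; apply: eq_bigr => -[].
  transitivity (\sum_i (\sum_j w i j * gdist R i j +
      fine (nu1 (cube R i)) * (d%:R / n.+2%:R))).
    apply: eq_bigr => i _; rewrite -w1 mulr_suml -big_split.
    by apply: eq_bigr => j _; rewrite kE thetaw /v/= mulrC mulrDr.
  by rewrite big_split/= -mulr_suml sum_cube_mass mul1r.
by rewrite lerD2r.
Qed.

Theorem proposition3 (R : realType) (d : nat) (hd : (1 <= d)%N)
    (nu1 nu2 : probability (borel (torus R d)) R) (H : nat) (hH : (1 <= H)%N) :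
  (W1 nu1 nu2 <=
    (6 * d%:R / H%:R
     + Num.sqrt d%:R / (2 * pi)
       * Num.sqrt
           (\sum_(h \in [set h : 'rV[int]_d | (0 < Zsupnorm h < H)%N])
               ComplexField.Normc.normc
                 (fourier_coef nu1 h - fourier_coef nu2 h) ^+ 2
               / enorm (Zvec R h) ^+ 2))%:E)%E.
Proof.
rewrite fsbig_freqs//; set Q := Num.sqrt (\sum_(h <- _ | _) _).
pose S : R := (size (freqs d H))%:R.
(* The bound obtained from the grid of mesh [t]. *)
pose phi (t : R) := 2 * (d%:R / H.+1%:R) +
  Num.sqrt d%:R / (2 * pi * cos (pi * (H%:R * t))) *
  (Q + S * (8 * pi * (d%:R * H%:R * t))) + d%:R * t.
have W1phi n : (H.*2 < n.+2)%N -> (W1 nu1 nu2 <= (phi n.+2%:R^-1)%:E)%E.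
  move=> Hn; apply: W1_le_grid => L f L0 fL.
  apply: lipschitz_pairing => //.
  - exact: undup_uniq.
  - exact: mem_freqs.
  - by move=> x; rewrite fine_ge0.
  - by move=> x; rewrite fine_ge0.
  - exact: sum_cube_mass.
  - exact: sum_cube_mass.
  - by rewrite mulr_ge0 ?mulr_ge0 ?invr_ge0 ?pi_ge0.
  move=> h; rewrite mem_freqs => /forallP hH'.
  have hle j : (`|h ord0 j| <= H)%N by exact: ltnW.
  set z := _ - _.
  have -> : z =
      (\sum_x gchar R h x * (fine (nu1 (@cube R d n x)))%:C%C - fourier_coef nu1 h)
    - (\sum_x gchar R h x * (fine (nu2 (@cube R d n x)))%:C%C - fourier_coef nu2 h).
    rewrite /z (_ : \sum_x _ =
      \sum_x gchar R h x * (fine (nu1 (@cube R d n x)))%:C%C -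
      \sum_x gchar R h x * (fine (nu2 (@cube R d n x)))%:C%C); first by ring.
    rewrite -sumrB; apply: eq_bigr => x _; rewrite -mulrBr; congr (_ * _).
    exact: rmorphB.
  apply: le_trans (le_normcD _ _) _; rewrite normcN.
  have -> : 8 * pi * (d%:R * H%:R / n.+2%:R) =
    4 * pi * (d%:R * H%:R / n.+2%:R) + 4 * pi * (d%:R * H%:R / n.+2%:R) :> R.
    by ring.
  by apply: lerD; exact: fourier_discretization.
have phi_cvg : phi n.+2%:R^-1 @[n --> \oo] --> phi 0.
  have u0 : (n.+2%:R^-1 : R) @[n --> \oo] --> (0 : R).
    by have := @cvg_harmonic R; rewrite -cvg_shiftS.
  have ct (a : R) : a * n.+2%:R^-1 @[n --> \oo] --> a * 0.
    exact: cvgM (cvg_cst a) u0.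
  apply: cvgD; last exact: ct.
  apply: cvgD; first exact: cvg_cst.
  apply: cvgM; last first.
    apply: cvgD; first exact: cvg_cst.
    by apply: cvgM; [exact: cvg_cst|apply: cvgM; [exact: cvg_cst|exact: ct]].
  apply: cvgM; first exact: cvg_cst.
  apply: cvgV; first by rewrite !mulr0 cos0 mulr1 mulf_neq0// gt_eqF// pi_gt0.
  apply: cvgM; first exact: cvg_cst.
  apply: continuous_cvg; first exact: continuous_cos.
  by apply: cvgM; [exact: cvg_cst|exact: ct].
have phi0 : phi 0 <= 6 * d%:R / H%:R + Num.sqrt d%:R / (2 * pi) * Q.
  rewrite /phi !mulr0 cos0 mulr1 !addr0 lerD2r -mulrA.
  have H0 : 0 < H%:R :> R by rewrite ltr0n.
  have le1 : d%:R / H.+1%:R <= d%:R / H%:R :> R.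
    by rewrite ler_wpM2l// lef_pV2 ?posrE ?ltr0n// ler_nat.
  have le0 : 0 <= d%:R / H%:R :> R by rewrite divr_ge0.
  apply: (le_trans (ler_wpM2l _ le1)) => //.
  by rewrite ler_wpM2r// ler_nat.
apply/lee_addgt0Pr => e e0.
have phi_lt : phi 0 < phi 0 + e by rewrite ltrDl.
have [n [Hn nphi]] := filter_ex (filterI (nbhs_infty_ge H.*2)
  (cvgr_lt _ phi_cvg _ phi_lt)).
apply: le_trans (W1phi n _) _; first by apply: leq_ltn_trans Hn _.
rewrite -EFinD lee_fin; apply: le_trans (ltW nphi) _.
by rewrite lerD2r.
Qed.
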